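(* Let $G$ be a connected graph of diameter $3$ which is not a block graph. Then $\lambda_2(G) < -1/2$ if and only if $G$ is (isomorphic to) a connected induced subgraph of the graph $Pt_1$ or of a triple block graph $Pt_2(p,q)$ for some integers $p,q\ge 2$.
   Context: All graphs are finite, simple and connected. $d_G(u,v)$ is the length of a shortest path between $u$ and $v$, and the diameter of $G$ is the maximum of $d_G(u,v)$. The distance matrix of $G$ with vertices $v_1,\dots,v_n$ is $\mathbf{D}(G)=[d_G(v_i,v_j)]$; its (real) eigenvalues, counted with multiplicity, are ordered $\lambda_1(G)\ge\lambda_2(G)\ge\cdots\ge\lambda_n(G)$. A block of a graph is a maximal connected subgraph that has no cut vertex. A block graph is a graph all of whose blocks are cliques (complete graphs). The diamond is $K_4$ minus one edge. The full house is the 5-vertex graph consisting of a $K_4$ together with one further vertex adjacent to exactly two vertices of the $K_4$. Each of these two graphs has exactly one minimal vertex separator (mvs), of cardinality $2$: in the diamond, the two vertices of degree $3$; in the full house, the two vertices of degree $4$. $Pt_1$ is the graph with $9$ vertices $o,p,q,r,t,s,x,y,z$ and edges $op, or, oq, pr, pq, qr, tp, tr, sp, rx, ry, rz, yz$ (a full house whose mvs is $\{p,r\}$, with one pendant edge attached at $p$, and one pendant edge and one triangle attached at $r$). For integers $p,q\ge 2$, a triple block graph $Pt_2(p,q)$ is a graph with exactly three blocks: one is a full house (or a diamond), the other two are cliques $K_p$ and $K_q$, and these two cliques are attached to the full house (or diamond) at the two distinct vertices of its mvs of cardinality $2$: $K_p$ shares with it exactly one of these two vertices and $K_q$ shares with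 it exactly the other one. *)

(* Defs.v *)
From mathcomp Require Import all_boot all_order all_algebra.
From mathcomp Require Import polyrcf.

Set Implicit Arguments.
Unset Strict Implicit.
Unset Printing Implicit Defensive.

Import Order.TTheory GRing.Theory Num.Theory.

Record sgraph := SGraph {
  vertex :> finType;
  adj : rel vertex;
  adj_sym : symmetric adj;
  adj_irr : irreflexive adj
}.

Section InducedSubgraph.
Variables (G : sgraph) (A : {set G}).

Definition induced_adj : rel {x : G | x \in A} :=
  fun x y => adj (val x) (val y).

Lemma induced_sym : symmetric induced_adj.
Proof. by move=> x y; apply: adj_sym. Qed.

Lemma induced_irr : irreflexive induced_adj.
Proof. by move=> x; apply: adj_irr. Qed.

Definition induced : sgraph := SGraph induced_sym induced_irr.

End InducedSubgraph.

Definition isomorphic (G H : sgraph) : Prop :=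
  exists2 f : G -> H, bijective f & {mono f : x y / adj x y}.

Section Connectivity.
Variable G : sgraph.
Implicit Types A B S : {set G}.

Definition connect_in A : rel G :=
  connect [rel x y | [&& x \in A, y \in A & adj x y]].

Definition connected_set A : bool :=
  [forall x in A, forall y in A, connect_in A x y].

Definition connected : bool := connected_set [set: G].

Definition clique A : bool :=
  [forall x in A, forall y in A, (x != y) ==> adj x y].

Definition cut_vertex A x : bool :=
  (x \in A) && ~~ connected_set (A :\ x).

(* Adding edges between vertices of a connected graph without cut vertex
   creates no cut vertex, so the maximal connected subgraphs without cut vertex
   are induced; a block is identified with its vertex set. *)
Definition nonseparable A : bool :=
  [&& A != set0, connected_set A & [forall x, ~~ cut_vertex A x]].

Definition blocks : {set {set G}} := [set B | maxset nonseparable B].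

Definition block_graph : bool := [forall B in blocks, clique B].

Definition separates S a b : bool :=
  [&& a \notin S, b \notin S & ~~ connect_in (~: S) a b].

(* Failure of [connect_in] forces [a] and [b] to be distinct and nonadjacent. *)
Definition mvs S : bool :=
  [exists a, exists b, minset (fun S' => separates S' a b) S].

End Connectivity.

Section Distance.
Variable G : sgraph.

Definition has_path_of_length (x y : G) (n : nat) : bool :=
  [exists p : n.-tuple G,
     [&& path (@adj G) x p, last x p == y & uniq (x :: p)]].

(* Paths have fewer than #|G| edges; the value is #|G| if there is none. *)
Definition dist (x y : G) : nat := find (has_path_of_length x y) (iota 0 #|G|).

Definition diameter : nat := \max_(x : G) \max_(y : G) dist x y.

Definition distance_matrix (R : nzRingType) : 'M[R]_#|G| :=
  (\matrix_(i, j) (dist (enum_val i) (enum_val j))%:R)%R.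

End Distance.

Section Eigenvalues.
Variable R : rcfType.
Local Open Scope ring_scope.

Definition eigenvalues n (A : 'M[R]_n) : seq R :=
  let p := char_poly A in
  sort >=%R (flatten [seq nseq (mup x p) x | x <- rootsR p]).

(* [lambda G k] is the k-th largest eigenvalue, numbered from 1. *)
Definition lambda (G : sgraph) (k : nat) : R :=
  (eigenvalues (distance_matrix G R))`_k.-1.

End Eigenvalues.

Section EdgeList.
Variables (n : nat) (E : seq (nat * nat)).

Definition edge_adj : rel 'I_n := fun i j =>
  (i != j) && (((val i, val j) \in E) || ((val j, val i) \in E)).

Lemma edge_sym : symmetric edge_adj.
Proof. by move=> i j; rewrite /edge_adj eq_sym orbC. Qed.

Lemma edge_irr : irreflexive edge_adj.
Proof. by move=> i; rewrite /edge_adj eqxx. Qed.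

Definition edge_graph : sgraph := SGraph edge_sym edge_irr.

End EdgeList.

Definition diamond : sgraph :=
  edge_graph 4 [:: (0, 1); (0, 2); (0, 3); (1, 2); (1, 3)].

Definition full_house : sgraph :=
  edge_graph 5 [:: (0, 1); (0, 2); (0, 3); (1, 2); (1, 3); (2, 3);
                   (4, 0); (4, 1)].

Definition Pt1 : sgraph :=
  let o := 0 in let p := 1 in let q := 2 in let r := 3 in let t := 4 in
  let s := 5 in let x := 6 in let y := 7 in let z := 8 in
  edge_graph 9 [:: (o, p); (o, r); (o, q); (p, r); (p, q); (q, r); (t, p);
                   (t, r); (s, p); (r, x); (r, y); (r, z); (y, z)].

Definition triple_block_graph (p q : nat) (G : sgraph) : Prop :=
  connected G /\
  exists B P Q : {set G},
    [/\ blocks G = [set B; P; Q] /\ #|blocks G| = 3,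
        isomorphic (induced B) full_house \/ isomorphic (induced B) diamond,
        clique P /\ #|P| = p,
        clique Q /\ #|Q| = q &
        exists u v : induced B,
          [/\ u != v, mvs [set u; v], B :&: P = [set val u]
            & B :&: Q = [set val v]]].

Definition connected_induced_subgraph_of (G H : sgraph) : Prop :=
  exists A : {set H}, connected (induced A) /\ isomorphic G (induced A).

(* Main.v *)
Require Import Defs.
From Stdlib Require Import ZArith.
From mathcomp Require Import all_boot all_order all_algebra.
From mathcomp Require Import polyrcf complex.
From mathcomp Require Import ssrZ ring lra.

(* Put M = 2D + I.  Then lambda_2 < -1/2 says that the quadratic form of M is
   negative definite on a hyperplane, a property inherited by the principal
   submatrices of M.

   If G is not a block graph, the forbidden small distance matrices provide an
   induced diamond with hubs p, r and further vertices o, t.  They also leave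
   only four possible rows of distances to p, r, o, t for the other vertices
   adjacent to p or r, and show that nothing else is adjacent to those.  So G is obtained
   from the diamond by adding at most one vertex q adjacent to p, r and one of
   o, t, and vertices attached to p alone or to r alone.  If the latter two sets
   are cliques, G is a Pt_2(p, q); otherwise a few more forbidden matrices leave
   only induced subgraphs of Pt_1.

   Conversely, in both families the vertices carry labels in Pt_1 which
   determine the distances, and the form of M, corrected by the square of a
   linear form, is minus an explicit sum of squares. *)

Set Implicit Arguments.
Unset Strict Implicit.
Unset Printing Implicit Defensive.

Import Order.TTheory GRing.Theory Num.Theory.
Import sesquilinear.

(** * Distances in connected graphs *)

(** The obstacle is that the family Pt_2(p, q) is infinite and not closed under induced subgraphs.
    Both families are therefore treated through maps to the nine vertices of Pt_1, which restrict to
    induced subgraphs; a clique of any size enters the form only through the sum and the sum of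
    squares of its coordinates. In the other direction the forbidden matrices are not listed. The
    diagonal entries of M are 1, so the indicator of a vertex b is a positive vector, and lambda_2 <
    -1/2 makes the form negative definite on its orthogonal. For the distances within a list of
    vertices this becomes positive definiteness of an integral Schur complement, decided by
    elimination. Diameter 3 leaves only the distances 1, 2, 3, so the possible rows of a further
    vertex form a finite table, and each structural claim is a check over such tables. The spectral
    theorem is applied over R[i]; its eigenvectors are complex, so the signature arguments use the
    hermitian form and come back to real vectors at the end. *)

Section Dist.
Variable G : sgraph.
Implicit Types x y z : G.

Lemma connect_inT x y : connect_in [set: G] x y = connect (@adj G) x y.
Proof. by apply: eq_connect => u v /=; rewrite !inE. Qed.

Lemma connectedP : reflect (forall x y, connect (@adj G) x y) (connected G).
Proof.
apply: (iffP forall_inP) => [h x y|h x _].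
  by have /forall_inP/(_ y) := h x (in_setT x); rewrite connect_inT inE; apply.
by apply/forall_inP => y _; rewrite connect_inT.
Qed.

(** [has_path_of_length] asks for a path without repetition, so the walk is shortened; the result
    has fewer than [#|G|] edges and lies in the range searched by [find]. *)
Lemma dist_le x p : path (@adj G) x p -> dist x (last x p) <= size p.
Proof.
move=> xp; have [q xq uq sub] := shortenP xp.
apply: leq_trans (uniq_leq_size (subseq_uniq _ _) sub); last 2 first.
- exact: subseq_refl.
- by case/andP: uq.
have qlt : size q < #|G|.
  by have := max_card (mem (x :: q)); rewrite (card_uniqP uq).
rewrite /dist; set y := last x q; case: leqP => // lt.
have := before_find 0 lt; rewrite nth_iota // add0n => /negbT/negP[].
by apply/existsP; exists (in_tuple q); rewrite /= xq eqxx.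
Qed.

Lemma dist_xx x : dist x x = 0.
Proof. by have := @dist_le x [::] isT; rewrite leqn0 => /eqP. Qed.

Hypothesis G_conn : connected G.

Lemma dist_path x y :
  exists p, [/\ path (@adj G) x p, last x p = y & size p = dist x y].
Proof.
have hs : has (has_path_of_length x y) (iota 0 #|G|).
  have /connectP[p xp ->] := connectedP G_conn x y.
  have [q xq uq _] := shortenP xp.
  apply/hasP; exists (size q).
    rewrite mem_iota /= add0n.
    by have := max_card (mem (x :: q)); rewrite (card_uniqP uq).
  by apply/existsP; exists (in_tuple q); rewrite /= xq eqxx.
have := nth_find 0 hs; have := hs; rewrite has_find size_iota => lt.
rewrite nth_iota // add0n -/(dist x y) => /existsP[p /and3P[xp /eqP lp _]].
by exists p; rewrite size_tuple.
Qed.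

Lemma dist_sym x y : dist x y = dist y x.
Proof.
suff le (u v : G) : dist u v <= dist v u by apply/eqP; rewrite eqn_leq !le.
have [p [vp lp <-]] := dist_path v u.
have <- : last u (rev (belast v p)) = v.
  by case: p vp lp => [//|a p] /= _ _; rewrite rev_cons last_rcons.
rewrite -(size_belast v p) -size_rev; apply: dist_le.
by rewrite -lp rev_path (eq_path (e' := @adj G)) // => a b; rewrite adj_sym.
Qed.

Lemma dist_tri x y z : dist x z <= dist x y + dist y z.
Proof.
have [p [xp lp <-]] := dist_path x y; have [q [yq lq <-]] := dist_path y z.
rewrite -size_cat -lq -[y]lp -last_cat; apply: dist_le.
by rewrite cat_path xp lp.
Qed.

Lemma dist0 x y : (dist x y == 0) = (x == y).
Proof.
apply/eqP/eqP => [d|->]; last exact: dist_xx.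
by have [p [_ lp]] := dist_path x y; rewrite d => /size0nil p0; rewrite -lp p0.
Qed.

Lemma dist_gt0 x y : (0 < dist x y) = (x != y).
Proof. by rewrite lt0n dist0. Qed.

Lemma dist1 x y : (dist x y == 1) = adj x y.
Proof.
apply/eqP/idP => [d|xy].
  have [[|a [|b p]] [xp lp]] := dist_path x y; rewrite d //= => _.
  by rewrite -lp; move: xp => /=; rewrite andbT.
apply/eqP; rewrite eqn_leq dist_gt0 (@dist_le x [:: y]) /= ?xy //=.
by apply: contraTneq xy => ->; rewrite adj_irr.
Qed.

Lemma dist_le2 x y : dist x y <= 2 ->
  [\/ x = y, adj x y | exists2 z, adj x z & adj z y].
Proof.
have [p [xp <- <-]] := dist_path x y.
case: p xp => [|a [|b [|c p]]] //= xp _; first exact: Or31.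
  by apply: Or32; case/andP: xp.
by apply: Or33; exists a; case/and3P: xp.
Qed.

Lemma dist2P x y : reflect [/\ x != y, ~~ adj x y & exists2 z, adj x z & adj z y]
  (dist x y == 2).
Proof.
apply: (iffP eqP) => [d|[ne na [z xz zy]]].
  have ne : x != y by rewrite -dist0 d.
  have na : ~~ adj x y by rewrite -dist1 d.
  split=> //; have [//|/eqP|h|//] := @dist_le2 x y; first by rewrite d.
    by rewrite (negbTE ne).
  by rewrite h in na.
apply/eqP; rewrite eqn_leq (@dist_le x [:: z; y]) /= ?xz ?zy //.
by rewrite ltn_neqAle eq_sym dist1 na dist_gt0.
Qed.

Lemma dist_ge3 x y : x != y -> ~~ adj x y -> (forall z, adj x z -> ~~ adj z y) ->
  2 < dist x y.
Proof.
move=> ne na nc; rewrite ltnNge; apply/negP => /dist_le2[e|a|[z xz zy]].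
- by rewrite e eqxx in ne.
- by rewrite a in na.
- by rewrite (negbTE (nc z xz)) in zy.
Qed.

Lemma adj_neq x y : adj x y -> x != y.
Proof. by apply: contraTneq => ->; rewrite adj_irr. Qed.

Lemma dist_diam x y : dist x y <= diameter G.
Proof.
by rewrite /diameter (bigD1 x) //= (bigD1 y) //= leq_max leq_max leqnn.
Qed.

Lemma diam_le d : (forall x y, dist x y <= d) -> diameter G <= d.
Proof. by move=> h; apply/bigmax_leqP => x _; apply/bigmax_leqP => y _. Qed.

(** Serves to produce vertices: when the diameter is 3, no vertex is adjacent to all others. *)
Lemma universal_diam u : (forall x, x != u -> adj u x) -> diameter G <= 2.
Proof.
move=> h; apply: diam_le => x y.
have le1 (z : G) : dist u z <= 1.
  have [->|zu] := eqVneq z u; first by rewrite dist_xx.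
  by rewrite leq_eqVlt dist1 h.
apply: leq_trans (dist_tri x u y) _; rewrite (dist_sym x).
exact: (leq_add (le1 x) (le1 y)).
Qed.
End Dist.


(** * Signature of symmetric matrices over a real closed field *)

Local Notation toC := (map_mx (real_complex _)).

Section Spectral.
Local Open Scope ring_scope.
Local Open Scope sesquilinear_scope.

Lemma char_poly_conj (F : comUnitRingType) n (P D : 'M[F]_n) :
  P \in unitmx -> char_poly (invmx P *m D *m P) = char_poly D.
Proof.
move=> Pu; rewrite /char_poly.
have -> : char_poly_mx (invmx P *m D *m P)
    = map_mx polyC (invmx P) *m char_poly_mx D *m map_mx polyC P.
  rewrite /char_poly_mx mulmxBr mulmxBl !map_mxM; congr (_ - _).
  by rewrite scalar_mxC -mulmxA -map_mxM mulVmx // map_mx1 mulmx1.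
rewrite !det_mulmx mulrAC -det_mulmx -map_mxM mulVmx // map_mx1 det1.
by rewrite mul1r.
Qed.

(** Allows [eigenvalues] to be compared with any factorisation of the characteristic polynomial into
    linear factors: the multiplicity of a root is its number of occurrences in [s]. *)
Lemma perm_roots_mup (R : rcfType) (s : seq R) :
  let p := \prod_(x <- s) ('X - x%:P) in
  perm_eq (flatten [seq nseq (mup x p) x | x <- rootsR p]) s.
Proof.
set p := \prod_(x <- s) _ => /=; apply/allP => y _ /=; apply/eqP.
rewrite count_flatten -map_comp.
have -> : [seq (count_mem y \o (fun x => nseq (mup x p) x)) x | x <- rootsR p]
   = [seq ((x == y) * count_mem y s)%N | x <- rootsR p].
  apply: eq_map => x /=; rewrite count_nseq /= mu_prod_XsubC.
  by case: eqP => [->|].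
rewrite sumnE big_map -big_distrl /=.
have -> : (\sum_(x <- rootsR p) (x == y))%N = count_mem y (rootsR p).
  by rewrite -big_mkcond sum1_count; apply: eq_count => x.
have p0 : p != 0 by rewrite monic_neq0 // monic_prod_XsubC.
rewrite count_uniq_mem ?uniq_roots //.
have := roots_on_rootsR p0 y; rewrite in_itv /= => <-.
rewrite root_prod_XsubC.
by case: (boolP (y \in s)) => [_|/count_memPn ->]; rewrite ?mul1n ?muln0.
Qed.

(** A real symmetric matrix is hermitian over R[i] and its spectrum is real. The factorisation of
    the characteristic polynomial is obtained over R[i] and descends by injectivity of the
    embedding; [P] remains complex. *)
Lemma spectral_rcf (R : rcfType) n (A : 'M[R]_n) : A^T = A ->
  exists (P : 'M[R[i]]_n) (e : 'rV[R]_n),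
    [/\ P \is unitarymx, toC A = P^t* *m diag_mx (toC e) *m P
      & perm_eq (eigenvalues A) [seq e 0 i | i <- enum 'I_n]].
Proof.
move=> Asym.
have Areal : toC A \is a realmx.
  by apply/mxOverP => i j; rewrite mxE complex_real.
have CAsym : toC A \is symmetricmx.
  apply/is_hermitianmxP; rewrite expr0 scale1r map_mx_id //.
  by apply/matrixP => i j; rewrite !mxE -{1}Asym mxE.
have CAherm := realsym_hermsym CAsym Areal.
have /mxOverP ereal := hermitian_spectral_diag_real CAherm.
have /orthomx_spectralP AE := hermitian_normalmx CAherm.
pose e : 'rV[R]_n := \row_j complex.Re (spectral_diag (toC A) 0 j).
have eE : spectral_diag (toC A) = toC e.
  by apply/rowP => j; rewrite !mxE RRe_real.
exists (spectralmx (toC A)), e; split; first exact: spectral_unitarymx.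
  by rewrite -invmx_unitary ?spectral_unitarymx // -eE.
have charA : char_poly A = \prod_(x <- [seq e 0 i | i <- enum 'I_n]) ('X - x%:P).
  apply: (@map_poly_inj _ _ (real_complex R)).
  rewrite map_char_poly AE char_poly_conj ?spectral_unit //.
  rewrite char_poly_trig; last exact/is_diag_mx_is_trig/diag_mx_is_diag.
  rewrite big_map big_enum /= rmorph_prod; apply: eq_bigr => i _.
  by rewrite rmorphB /= map_polyX map_polyC eE !mxE eqxx mulr1n.
by rewrite /eigenvalues charA perm_sort; apply: perm_roots_mup.
Qed.

Lemma sort_second_lt (R : rcfType) (s : seq R) (c : R) : (1 < size s)%N ->
  ((sort >=%R s)`_1 < c) = (count (>= c) s <= 1)%N.
Proof.
rewrite -(size_sort >=%R) -(permP (permEl (perm_sort >=%R s))).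
have : sorted >=%R (sort >=%R s) by apply: sort_sorted => x y; apply: le_total.
case: (sort >=%R s) => [|a [|b t]] //= /andP[ba pth] _.
case: (ltP b c) => [bc|cb]; last by rewrite (le_trans cb ba).
rewrite add0n; have -> : count (>= c) t = 0%N.
  apply/eqP; rewrite -leqn0 leqNgt -has_count; apply/hasPn => x xt.
  have /allP/(_ _ xt) := order_path_min ge_trans pth.
  by rewrite -ltNge => /le_lt_trans; apply.
by rewrite addn0 leq_b1.
Qed.

(** Indices, unlike values, account for multiplicities. The bound on n keeps entry 1 of the list
    from being the default value of [nth]. *)
Lemma lambda2_lt (R : rcfType) n (A : 'M[R]_n) (c : R) (e : 'rV[R]_n) :
  (1 < n)%N -> perm_eq (eigenvalues A) [seq e 0 i | i <- enum 'I_n] ->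
  (eigenvalues A)`_1 < c <-> (forall i j, c <= e 0 i -> c <= e 0 j -> i = j).
Proof.
move=> n1 pe.
have -> : eigenvalues A = sort >=%R (eigenvalues A).
  rewrite sorted_sort //; first exact: ge_trans.
  by apply: sort_sorted => x y; apply: le_total.
have sz : size (eigenvalues A) = n by rewrite (perm_size pe) size_map size_enum_ord.
rewrite (@sort_second_lt _ (eigenvalues A)) ?sz // (permP pe) count_map.
rewrite -size_filter.
have -> : size [seq x <- enum 'I_n | preim [eta e 0] (>= c) x]
    = #|[pred i | c <= e 0 i]|.
  by rewrite cardE /enum_mem -filter_predI; congr size;
      apply: eq_filter => i /=; rewrite !inE andbT.
split=> [/card_le1_eqP h i j ci cj | h].
  by apply/esym/h; rewrite inE.
by apply/card_le1_eqP => i j; rewrite !inE => ci cj; apply/esym/h.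
Qed.

Lemma bilinear_comb (K : comPzRingType) n (N : 'M[K]_n) (z t : 'rV_n) (z' t' : 'cV_n)
    a b a' b' :
  ((a *: z + b *: t) *m N *m (a' *: z' + b' *: t')) 0 0 =
  a * a' * (z *m N *m z') 0 0 + a * b' * (z *m N *m t') 0 0
  + b * a' * (t *m N *m z') 0 0 + b * b' * (t *m N *m t') 0 0.
Proof.
rewrite mulmxDl mulmxDr !mulmxDl -!scalemxAr -!scalemxAl !scalerA.
move: (z *m N *m z') (z *m N *m t') (t *m N *m z') (t *m N *m t').
by move=> zz zt tz tt; rewrite !mxE; ring.
Qed.

End Spectral.

Section Form.
Local Open Scope ring_scope.
Local Open Scope sesquilinear_scope.
Variables (R : rcfType) (n : nat) (A : 'M[R]_n).
Hypothesis A_sym : A^T = A.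
Let M : 'M[R]_n := A *+ 2 + 1%:M.
Definition qform (u v : 'rV[R]_n) : R := (u *m M *m v^T) 0 0.

Let C := R[i].
Definition herm_form (z t : 'rV[C]_n) : C := (z *m toC M *m t^t*) 0 0.

Let M_sym : M^T = M.
Proof. by rewrite /M linearD linearMn /= A_sym trmx1. Qed.

Lemma qformC u v : qform u v = qform v u.
Proof.
have -> : qform u v = (u *m M *m v^T)^T 0 0 by rewrite mxE.
by rewrite !trmx_mul trmxK M_sym mulmxA.
Qed.

Lemma herm_form_toC u v : herm_form (toC u) (toC v) = (qform u v)%:C%C.
Proof.
rewrite /herm_form /qform.
have -> : (toC v)^t* = toC v^T.
  by apply/matrixP => i j; rewrite !mxE; apply/CrealP; rewrite complex_real.
by rewrite -!map_mxM mxE.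
Qed.

Lemma herm_form_comb (z t : 'rV[C]_n) a b :
  herm_form (a *: z + b *: t) (a *: z + b *: t) =
  a * a^* * herm_form z z + a * b^* * herm_form z t
  + b * a^* * herm_form t z + b * b^* * herm_form t t.
Proof.
have tE : (a *: z + b *: t)^t* = a^* *: z^t* + b^* *: t^t*.
  by apply/matrixP => i j; rewrite !mxE rmorphD !rmorphM.
by rewrite /herm_form tE bilinear_comb.
Qed.

Variables (P : 'M[C]_n) (e : 'rV[R]_n).
Hypotheses (P_unitary : P \is unitarymx)
  (AE : toC A = P^t* *m diag_mx (toC e) *m P).

(** In the coordinates [w] the form is diagonal, and the sign of the coefficient 2 e_i + 1 compares
    e_i with -1/2. *)
Lemma herm_form_spectral z (w := z *m P^t*) :
  herm_form z z = \sum_i (e 0 i *+ 2 + 1)%:C%C * `|w 0 i| ^+ 2.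
Proof.
have zE : z = w *m P by rewrite /w mulmxKtV.
have DE : toC M = P^t* *m diag_mx (toC (map_mx (fun x => x *+ 2 + 1) e)) *m P.
  have -> : diag_mx (toC (map_mx (fun x => x *+ 2 + 1) e))
     = diag_mx (toC e) *+ 2 + 1%:M.
    apply/matrixP => i j; rewrite !mxE rmorphD rmorphMn rmorph1 /=.
    by case: (i == j); rewrite ?mulr1n ?mulr0n ?mul0rn ?addr0.
  rewrite mulmxDr mulmxDl mulmx1 /M map_mxD map_mx1 !mulr2n map_mxD /= AE.
  have /mulmx1C -> : P *m P^t* = 1%:M by apply/unitarymxP.
  by rewrite mulmxDr mulmxDl.
have wE : P *m z^t* = w^t* by rewrite trmx_mul map_mxM /= trmxCK.
rewrite /herm_form DE !mulmxA -/w -(mulmxA _ P) wE mxE; apply: eq_bigr => i _.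
rewrite mul_mx_diag !mxE normCK; ring.
Qed.
End Form.

Section Signature.
Local Open Scope ring_scope.
Local Open Scope sesquilinear_scope.
Variables (R : rcfType) (n : nat) (A : 'M[R]_n).
Hypotheses (A_sym : A^T = A) (n_gt1 : (1 < n)%N).

(** Inertia argument: all coefficients 2 e_i + 1 are negative except perhaps the one at [i0], so the
    form is negative definite on vectors with vanishing [i0] coordinate. If v is not such a vector,
    the combination of u and v that cancels this coordinate is; by orthogonality its value is |a|^2
    q(u) + |b|^2 q(v), and q(u) > 0 forces q(v) < 0. *)
Lemma signature_necessary (u v : 'rV[R]_n) :
  (eigenvalues A)`_1 < - (1 / 2) -> 0 < qform A u u -> qform A u v = 0 -> v != 0 ->
  qform A v v < 0.
Proof.
have [P [e [Pu AE pe]]] := spectral_rcf A_sym.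
move/(lambda2_lt _ n_gt1 pe) => lam uu uv v0.
pose f i := e 0 i *+ 2 + 1.
have [i0 neg] : exists i0, forall i, i != i0 -> f i < 0.
  case: (pickP [pred i | - (1 / 2) <= e 0 i]) => [i0 /= ci0|no].
    exists i0 => i; apply: contraNT; rewrite -leNgt => fi; apply/eqP/lam => //.
    by move: fi; rewrite /f; lra.
  exists (Ordinal (ltnW n_gt1)) => i _.
  by move: (no i) => /= /negbT; rewrite -ltNge /f; lra.
have hneg z : (z *m P^t*) 0 i0 = 0 -> herm_form A z z <= 0.
  move=> z0; rewrite (herm_form_spectral Pu AE); apply: sumr_le0 => i _.
  have [->|ne] := eqVneq i i0; first by rewrite z0 normr0 expr0n mulr0.
  by rewrite mulr_le0_ge0 // ?exprn_ge0 // lecR ltW // neg.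
have hneg0 z : (z *m P^t*) 0 i0 = 0 -> herm_form A z z = 0 -> z = 0.
  move=> z0 hz.
  suff w0 : z *m P^t* = 0 by rewrite -[z](mulmxKtV z Pu (erefl n)) w0 mul0mx.
  apply/rowP => i; rewrite [RHS]mxE.
  have [->|ne] := eqVneq i i0; first by [].
  move/eqP: hz; rewrite (herm_form_spectral Pu AE) -oppr_eq0 -sumrN psumr_eq0.
    move/allP/(_ i); rewrite mem_index_enum => /(_ isT) /=.
    rewrite oppr_eq0 mulf_eq0 expf_eq0 /= normr_eq0 => /orP[|/eqP //].
    by move/eqP/(congr1 (@complex.Re _)) => /= fi; have := neg i ne; rewrite /f fi ltxx.
  move=> j _; rewrite oppr_ge0.
  have [->|nej] := eqVneq j i0; first by rewrite z0 normr0 expr0n mulr0.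
  by rewrite mulr_le0_ge0 // ?exprn_ge0 // lecR ltW // neg.
set a := (toC v *m P^t*) 0 i0.
have [a0|an0] := eqVneq a 0.
  rewrite lt_neqAle; apply/andP; split; last first.
    by have := hneg _ a0; rewrite herm_form_toC lecR.
  apply: contra_neq v0 => vv.
  have /rowP h : toC v = 0 by apply: hneg0 => //; rewrite herm_form_toC vv.
  apply/rowP => i.
  by have := h i; rewrite !mxE => /(@complexI _).
set b := - (toC u *m P^t*) 0 i0.
have := hneg (a *: toC u + b *: toC v).
rewrite mulmxDl -!scalemxAl [X in X = 0 -> _]mxE.
rewrite [X in X + _]mxE [X in _ + X]mxE -/a /b.
rewrite mulNr mulrC subrr => /(_ erefl).
rewrite herm_form_comb !herm_form_toC (qformC A_sym v u) uv !mulr0 !addr0 -/b.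
have : 0 < a * a^* by rewrite mul_conjC_gt0.
have : 0 <= b * b^* by rewrite mul_conjC_ge0.
move=> b0 a0 le; rewrite ltNge; apply/negP => vv; move: le.
rewrite lt_geF //; apply: ltr_pwDl; first by rewrite mulr_gt0 // ltcR.
by rewrite mulr_ge0 // ler0c.
Qed.

(** Two eigenvalues at least -1/2 would give a complex plane on which the form is nonnegative. This
    plane meets the hyperplane of [l] in some nonzero z. The real and imaginary parts of z lie in
    the real hyperplane, and the value at z is the sum of their values, hence negative. *)
Lemma signature_sufficient (l : 'cV[R]_n) :
  (forall v : 'rV[R]_n, v != 0 -> v *m l = 0 -> qform A v v < 0) ->
  (eigenvalues A)`_1 < - (1 / 2).
Proof.
move=> neg; have [P [e [Pu AE pe]]] := spectral_rcf A_sym.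
apply/(lambda2_lt _ n_gt1 pe) => i j ei ej; apply/eqP/negPn/negP => ij.
have [a [b [ab0 lab]]] : exists a b : R[i], (a != 0) || (b != 0) /\
   (a *: row i P + b *: row j P) *m toC l = 0.
  set p := (row i P *m toC l) 0 0; set q := (row j P *m toC l) 0 0.
  have [p0|pn0] := eqVneq p 0.
    exists 1, 0; rewrite oner_eq0; split => //.
    by rewrite scale1r scale0r addr0; apply/matrixP => ? ?; rewrite !ord1 [RHS]mxE.
  exists q, (- p); rewrite oppr_eq0 pn0 orbT; split => //.
  apply/matrixP => ? ?; rewrite !ord1 mulmxDl -!scalemxAl [LHS]mxE.
  rewrite [X in X + _]mxE [X in _ + X]mxE -/p -/q [RHS]mxE; ring.
set z := a *: row i P + b *: row j P in lab.
have wE : z *m P^t* = a *: delta_mx 0 i + b *: delta_mx 0 j.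
  rewrite /z !rowE mulmxDl -!scalemxAl -!mulmxA.
  by have /unitarymxP -> := Pu; rewrite !mulmx1.
have z0 : z != 0.
  apply: contraTneq ab0 => z0; move: wE; rewrite z0 mul0mx => /esym/rowP w.
  have := w i; have := w j; rewrite !mxE !eqxx eq_sym (negbTE ij) /=.
  by rewrite !mulr1 !mulr0 addr0 add0r => -> ->; rewrite eqxx.
have hz : 0 <= herm_form A z z.
  rewrite (herm_form_spectral Pu AE) wE; apply: sumr_ge0 => k _; rewrite !mxE /=.
  have [ki|nki] := eqVneq k i; first by rewrite ki mulr_ge0 ?exprn_ge0 // ler0c; lra.
  have [kj|nkj] := eqVneq k j; first by rewrite kj mulr_ge0 ?exprn_ge0 // ler0c; lra.
  by rewrite !mulr0 addr0 normr0 expr0n mulr0.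
clearbody z; pose x : 'rV[R]_n := \row_k complex.Re (z 0 k).
pose y : 'rV[R]_n := \row_k complex.Im (z 0 k).
have zxy : z = 1 *: toC x + 'i *: toC y.
  by rewrite scale1r; apply/rowP => k; rewrite !mxE; apply: complexE.
have xl : x *m l = 0 /\ y *m l = 0.
  have : toC (x *m l) + 'i *: toC (y *m l) = 0.
    by rewrite !map_mxM scalemxAl -mulmxDl -[toC x]scale1r -zxy lab.
  move: (x *m l) (y *m l) => X Y /matrixP h.
  split; apply/matrixP => k m; move: (h k m); rewrite !mxE.
    by move/(congr1 (@complex.Re _)) => /=; rewrite mul0r mulr0 subr0 addr0.
  by move/(congr1 (@complex.Im _)) => /=; rewrite mul1r mul0r !add0r.
have xy0 : (x != 0) || (y != 0).
  apply: contraNT z0; rewrite negb_or !negbK => /andP[/eqP x0 /eqP y0].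
  by rewrite zxy x0 y0 !map_mx0 !scaler0 addr0.
have neg' v : v *m l = 0 -> qform A v v <= 0.
  move=> vl; have [->|v0] := eqVneq v 0; last exact/ltW/neg.
  by rewrite /qform mul0mx mul0mx mxE.
have : qform A x x + qform A y y < 0.
  case/orP: xy0 => h.
    by apply: ltr_wnDr (neg' _ xl.2) (neg _ h xl.1).
  by apply: ltr_wnDl (neg' _ xl.1) (neg _ h xl.2).
rewrite ltNge => /negP[]; move: hz.
rewrite zxy herm_form_comb !herm_form_toC (qformC A_sym y x) rmorph1.
rewrite -ler0c; congr (_ <= _).
have ii : 'i * 'i^* = 1 :> R[i] by rewrite conjCi mulrN -expr2 sqrCi opprK.
by rewrite ii conjCi rmorphD /=; ring.
Qed.
End Signature.

(** * The form of 2D + I in coordinates indexed by the vertices *)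

Section DistForm.
Local Open Scope ring_scope.
Variables (R : rcfType) (G : sgraph).
Hypotheses (G_conn : connected G) (G_gt1 : (1 < #|G|)%N).

Definition shifted_dist (x z : G) : R := (dist x z)%:R *+ 2 + (x == z)%:R.
Definition dist_form (y y' : G -> R) : R :=
  \sum_x \sum_z shifted_dist x z * (y x * y' z).

Let D := distance_matrix G R.
Let row_of (y : G -> R) : 'rV[R]_#|G| := \row_i y (enum_val i).

Let D_sym : D^T = D.
Proof. by apply/matrixP => i j; rewrite !mxE dist_sym. Qed.

Lemma sum_enum_val (F : G -> R) : \sum_x F x = \sum_(i < #|G|) F (enum_val i).
Proof. by rewrite -big_enum_val. Qed.

Let qformE y y' : qform D (row_of y) (row_of y') = dist_form y y'.
Proof.
rewrite /qform -mulmxA mxE /dist_form sum_enum_val; apply: eq_bigr => i _.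
rewrite [X in _ * X]mxE big_distrr sum_enum_val /=; apply: eq_bigr => j _.
by rewrite !mxE /shifted_dist (inj_eq enum_val_inj); ring.
Qed.

(** The positive vector is the indicator of [b], whose value is the diagonal entry 1; the equation
    on [y] expresses orthogonality to it. *)
Lemma lambda2_necessary (b : G) (y : G -> R) :
  lambda R G 2 < - (1 / 2) -> \sum_z shifted_dist b z * y z = 0 ->
  (exists z, y z != 0) -> dist_form y y < 0.
Proof.
move=> lam yb [z yz]; rewrite -qformE.
have gb y' : dist_form (fun x => (x == b)%:R) y' = \sum_z shifted_dist b z * y' z.
  rewrite /dist_form (bigD1 b) //= [X in _ + X]big1 ?addr0 => [|x /negbTE xb].
    by apply: eq_bigr => x _; rewrite eqxx mul1r.
  by rewrite big1 // => t _; rewrite xb mul0r mulr0.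
apply: (@signature_necessary _ _ _ D_sym G_gt1 (row_of (fun x => (x == b)%:R))) => //.
- rewrite qformE gb (bigD1 b) //= big1 => [|x /negbTE xb].
    by rewrite /shifted_dist dist_xx !eqxx mul0rn add0r mulr1 addr0 ltr01.
  by rewrite xb mulr0.
- by rewrite qformE gb.
- apply: contraNneq yz => /rowP/(_ (enum_rank z)); rewrite !mxE enum_rankK => ->.
  by [].
Qed.

Lemma lambda2_sufficient (l : G -> R) :
  (forall y : G -> R, (exists z, y z != 0) -> \sum_z l z * y z = 0 ->
     dist_form y y < 0) ->
  lambda R G 2 < - (1 / 2).
Proof.
move=> h.
apply: (@signature_sufficient _ _ _ D_sym G_gt1 (\col_i l (enum_val i))) => v v0 vl.
have vE : v = row_of (fun x => v 0 (enum_rank x)).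
  by apply/rowP => i; rewrite mxE enum_valK.
rewrite vE qformE; apply: h.
  have /rV0Pn[i vi] := v0; by exists (enum_val i); rewrite enum_valK.
rewrite sum_enum_val; move/matrixP/(_ 0 0): vl; rewrite !mxE => vl0.
by rewrite -[RHS]vl0; apply: eq_bigr => i _; rewrite enum_valK mxE mulrC.
Qed.
End DistForm.

(** * Sufficiency: graphs labelled by the vertices of Pt1 *)

(* The labels are the vertices of [Pt1], numbered as there: o, p, q, r, t, s, x,
   y, z are 0, ..., 8. *)
Definition ladj (k l : nat) : bool :=
  let E := [:: (0, 1); (0, 3); (0, 2); (1, 3); (1, 2); (2, 3); (4, 1);
               (4, 3); (5, 1); (3, 6); (3, 7); (3, 8); (7, 8)] in
  ((k, l) \in E) || ((l, k) \in E).

(** Meant for two distinct vertices carrying these labels, hence the value 1 for equal labels. Two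
    nonadjacent labels with a common neighbour have one of the hubs 1 and 3 as common neighbour, so
    only these are tested. *)
Definition ldist (k l : nat) : nat :=
  if (k == l) || ladj k l then 1
  else if (ladj k 1 && ladj 1 l) || (ladj k 3 && ladj 3 l) then 2 else 3.

Lemma ladj_sym k l : ladj k l = ladj l k.
Proof. by rewrite /ladj orbC. Qed.

Lemma ladj_irr (k : 'I_9) : ladj k k = false.
Proof. by case: k; do 9?[case=> //]. Qed.

Lemma all_labels2 (f : nat -> nat -> bool) :
  all (fun k => all (f k) (iota 0 9)) (iota 0 9) -> forall k l : 'I_9, f k l.
Proof.
move=> /allP h k l; have := h k; rewrite mem_iota ltn_ord => /(_ isT)/allP.
by apply; rewrite mem_iota ltn_ord.
Qed.

(** Certificate for distance 3: a path through both hubs, and disjoint closed neighbourhoods. The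
    neighbourhoods are closed because consecutive vertices of a path in [G] may share a label. *)
Definition remote (k l : nat) : bool :=
  (ladj k 1 && ladj 3 l || ladj k 3 && ladj 1 l) &&
  all (fun m => ~~ (((k == m) || ladj k m) && ((m == l) || ladj m l)))
    (iota 0 9).

Lemma ldist3_remote (k l : 'I_9) : ldist k l = 3 -> remote k l.
Proof.
move/eqP; apply/implyP.
apply: (@all_labels2 (fun k l => (ldist k l == 3) ==> remote k l)).
by vm_compute.
Qed.

Section Labelling.
Variables (G : sgraph) (c : G -> 'I_9).

Definition label_adjacency : Prop :=
  forall x y, x != y -> adj x y = (c x == c y) || ladj (c x) (c y).

(* When the labels 7 and 8 are unused, the vertices 5 and 6 of [Pt1] may be
   replaced by cliques; this gives the graphs Pt_2(p, q). *)
Definition labelling : Prop :=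
  label_adjacency /\
  ((forall x y, c x = c y -> x = y \/ 4 < c x) /\ (forall x, c x < 7)
   \/ injective c).

Hypotheses (G_conn : connected G) (c_lab : labelling).

Lemma connected_invariant (T : eqType) (f : G -> T) :
  (forall x y, adj x y -> f x = f y) -> forall x y, f x = f y.
Proof.
move=> h x y; have /connectP[p xp ->] := connectedP G G_conn x y.
by elim: p x xp => //= z p IH x /andP[/h -> /IH].
Qed.

Lemma label_adj x y : x != y -> adj x y = (c x == c y) || ladj (c x) (c y).
Proof. by case: c_lab => h _; apply: h. Qed.

Lemma adj_label x y : adj x y -> (c x == c y) || ladj (c x) (c y).
Proof. by move=> xy; rewrite -label_adj // (@adj_neq G). Qed.

Lemma ladj_adj x y : ladj (c x) (c y) -> adj x y.
Proof.
move=> xy; rewrite label_adj ?xy ?orbT //.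
by apply: contraTneq xy => ->; rewrite ladj_irr.
Qed.

Lemma label1_inj x y : c x < 5 -> c x = c y -> x = y.
Proof.
move=> x5 xy; case: c_lab => _ [[/(_ x y xy)[//|]]|inj]; last exact: inj.
by move=> x4 _; move: x5; rewrite ltnS leqNgt x4.
Qed.

(** The hubs supply the paths of length 2 and 3. Conversely the labels along a path of [G] are
    successively equal or adjacent in Pt_1, so [remote] excludes a shorter path. *)
Lemma label_dist p r x y : c p = 1 :> nat -> c r = 3 :> nat -> x != y ->
  dist x y = ldist (c x) (c y).
Proof.
move=> cp cr xy; rewrite /ldist.
have E : (c x == c y :> nat) = (c x == c y) by [].
have xp z : ladj (c z) 1 -> adj z p by move=> ?; apply: ladj_adj; rewrite cp.
have px z : ladj 1 (c z) -> adj p z by move=> ?; apply: ladj_adj; rewrite cp.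
have xr z : ladj (c z) 3 -> adj z r by move=> ?; apply: ladj_adj; rewrite cr.
have rx z : ladj 3 (c z) -> adj r z by move=> ?; apply: ladj_adj; rewrite cr.
case: ifP => h1; first by apply/eqP; rewrite dist1 // label_adj // -E.
have na : ~~ adj x y by rewrite label_adj // -E h1.
case: ifP => h2.
  apply/eqP/dist2P => //; split=> //.
  case/orP: h2 => /andP[a b].
    by exists p; [apply: xp | apply: px].
  by exists r; [apply: xr | apply: rx].
have /ldist3_remote/andP[path3 no2] : ldist (c x) (c y) = 3 by rewrite /ldist h1 h2.
apply/eqP; rewrite eqn_leq; apply/andP; split; last first.
  apply: dist_ge3 => // z /adj_label xz; apply/negP => /adj_label zy.
  have /allP/(_ (c z)) := no2; rewrite mem_iota ltn_ord => /(_ isT).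
  by rewrite -!val_eqE /= in xz zy *; rewrite xz zy.
have pr : adj p r by apply: ladj_adj; rewrite cp cr.
case/orP: path3 => /andP[a b].
  by apply: (@dist_le G x [:: p; r; y]); rewrite /= xp // pr rx.
by apply: (@dist_le G x [:: r; p; y]); rewrite /= xr // adj_sym pr px.
Qed.

(** A labelling need not hit the hubs. If one hub is missing, connectedness removes the labels
    attached to it alone, and the other hub is adjacent to everything; if both are missing, [G] is a
    clique. The diameter would be at most 2. *)
Lemma label_hubs : diameter G = 3 ->
  (exists p, c p = 1 :> nat) /\ (exists r, c r = 3 :> nat).
Proof.
move=> diam.
have nouniv (u : G) : exists2 x, x != u & ~~ adj u x.
  case: (pickP [pred x | (x != u) && ~~ adj u x]) => [x /andP[]|no].
    by exists x.
  suff: diameter G <= 2 by rewrite diam.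
  apply: (@universal_diam G G_conn u) => x xu.
  by move/(_ x)/negbT: no => /=; rewrite xu negbK.
case: (pickP [pred p | c p == 1 :> nat]) => [p /eqP cp|nop];
  case: (pickP [pred p | c p == 3 :> nat]) => [r /eqP cr|nor].
- by split; [exists p | exists r].
- have [x xp /negP[]] := nouniv p; rewrite ladj_adj //.
  have := @connected_invariant _ (fun x => 5 < c x) _ p x; rewrite cp => H.
  have {H} : 5 < c x = false.
    apply/esym/H => {H} u v /adj_label.
    move/negbT: (nor u); move/negbT: (nor v) => /=; rewrite -val_eqE /=.
    by case: (c u) (c v) => [[|[|[|[|[|[|[|[|[|?]]]]]]]]] ?]
        [[|[|[|[|[|[|[|[|[|?]]]]]]]]] ?].
  move/negbT: (nor x) => /=.
  have : c x <> 1 :> nat.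
    by move=> cx; move: xp; rewrite (@label1_inj x p) ?eqxx // ?cx //;
        apply: ord_inj; rewrite cx.
  by case: (c x) => [] [|[|[|[|[|[|[|[|[|?]]]]]]]]].
- have [x xp /negP[]] := nouniv r; rewrite ladj_adj //.
  have := @connected_invariant _ (fun x => c x == 5 :> nat) _ r x; rewrite cr => H.
  have {H} : (c x == 5 :> nat) = false.
    apply/esym/H => {H} u v /adj_label.
    move/negbT: (nop u); move/negbT: (nop v) => /=; rewrite -val_eqE /=.
    by case: (c u) (c v) => [[|[|[|[|[|[|[|[|[|?]]]]]]]]] ?]
        [[|[|[|[|[|[|[|[|[|?]]]]]]]]] ?].
  move/negbT: (nop x) => /=.
  have : c x <> 3 :> nat.
    by move=> cx; move: xp; rewrite (@label1_inj x r) ?eqxx // ?cx //;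
        apply: ord_inj; rewrite cx.
  by case: (c x) => [] [|[|[|[|[|[|[|[|[|?]]]]]]]]].
(* Numbers the components of Pt_1 without its hubs, each of which is a clique; the entries at 1 and
   3 are fillers. *)
- pose f x := nth 0 [:: 0; 0; 0; 0; 1; 2; 3; 4; 4] (c x).
  suff : diameter G <= 1 by rewrite diam.
  apply: diam_le => x y.
  have fxy : f x = f y.
    apply: connected_invariant => {}x {}y /adj_label.
    move/negbT: (nop x); move/negbT: (nop y) => /=.
    move/negbT: (nor x); move/negbT: (nor y) => /=; rewrite /f -val_eqE /=.
    by case: (c x) (c y) => [[|[|[|[|[|[|[|[|[|?]]]]]]]]] ?]
        [[|[|[|[|[|[|[|[|[|?]]]]]]]]] ?].
  have [->|xy] := eqVneq x y; first by rewrite dist_xx.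
  rewrite leq_eqVlt dist1 // label_adj //.
  move: fxy; move/negbT: (nop x); move/negbT: (nop y) => /=.
  move/negbT: (nor x); move/negbT: (nor y) => /=; rewrite /f -val_eqE /=.
  by case: (c x) (c y) => [[|[|[|[|[|[|[|[|[|?]]]]]]]]] ?]
      [[|[|[|[|[|[|[|[|[|?]]]]]]]]] ?].
Qed.
End Labelling.

(** * The quadratic form in the sums over the label classes *)

Section Quadratic.
Local Open Scope ring_scope.
Variables (R : realFieldType) (s : nat -> R).

(* The sum of squares comes from the LDL^T decomposition of the form, starting
   with the label 1. *)
Definition label_sos : R :=
  3 * (s 3 + 2 / 3 * (s 0 + s 2 + s 4) + 2 * (s 6 + s 7 + s 8)) ^+ 2
  + 5 / 3 * (s 0 + 2 / 5 * s 2 - 4 / 5 * s 4) ^+ 2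
  + 7 / 5 * (s 2 - 4 / 7 * s 4) ^+ 2 + 1 / 7 * s 4 ^+ 2
  + 3 * (s 5 + 2 / 3 * (s 6 + s 7 + s 8)) ^+ 2
  + 5 / 3 * (s 6 - 4 / 5 * (s 7 + s 8)) ^+ 2
  + 3 / 5 * (s 7 - 2 / 3 * s 8) ^+ 2 + 1 / 3 * s 8 ^+ 2.

(** The row of the hub 1 in 2D + I applied to the class sums. As [ldist 1 1] is 1, the subtraction
    of [s 1] restores the diagonal entry. *)
Definition label_lin : R := \sum_(0 <= k < 9) (ldist 1 k)%:R *+ 2 * s k - s 1.

Lemma label_linE : label_lin =
  s 1 + 2 * (s 3 + s 0 + s 2 + s 4 + s 5) + 4 * (s 6 + s 7 + s 8).
Proof.
by rewrite /label_lin /index_iota /= !big_cons big_nil /ldist /=; ring.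
Qed.

Lemma label_quadratic :
  \sum_(0 <= k < 9) \sum_(0 <= l < 9) (ldist k l)%:R *+ 2 * (s k * s l) =
  label_lin ^+ 2 + \sum_(0 <= k < 9) s k ^+ 2 - label_sos.
Proof.
by rewrite label_linE /label_sos /index_iota /= !big_cons !big_nil /ldist /=; field.
Qed.

(** The eight squares are triangular in the variables other than [s 1], so these vanish one after
    another from [s 8] on; the linear form then gives [s 1]. *)
Lemma label_sos_eq0 : label_lin = 0 -> label_sos <= 0 ->
  forall k, (k < 9)%N -> s k = 0.
Proof.
rewrite label_linE /label_sos.
have := sqr_ge0 (s 3 + (2 / 3) * (s 0 + s 2 + s 4) + 2 * (s 6 + s 7 + s 8)).
have := sqr_ge0 (s 0 + 2 / 5 * s 2 - 4 / 5 * s 4).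
have := sqr_ge0 (s 2 - 4 / 7 * s 4); have := sqr_ge0 (s 4).
have := sqr_ge0 (s 5 + 2 / 3 * (s 6 + s 7 + s 8)).
have := sqr_ge0 (s 6 - 4 / 5 * (s 7 + s 8)).
have := sqr_ge0 (s 7 - 2 / 3 * s 8); have := sqr_ge0 (s 8).
move=> h1 h2 h3 h4 h5 h6 h7 h8 lin sos.
have /eqP : s 8 ^+ 2 = 0 by lra.
rewrite sqrf_eq0 => /eqP z8.
have /eqP : (s 7 - 2 / 3 * s 8) ^+ 2 = 0 by lra.
rewrite sqrf_eq0 z8 => /eqP z7.
have /eqP : (s 6 - 4 / 5 * (s 7 + s 8)) ^+ 2 = 0 by lra.
rewrite sqrf_eq0 => /eqP z6.
have /eqP : (s 5 + 2 / 3 * (s 6 + s 7 + s 8)) ^+ 2 = 0 by lra.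
rewrite sqrf_eq0 => /eqP z5.
have /eqP : s 4 ^+ 2 = 0 by lra.
rewrite sqrf_eq0 => /eqP z4.
have /eqP : (s 2 - 4 / 7 * s 4) ^+ 2 = 0 by lra.
rewrite sqrf_eq0 => /eqP z2.
have /eqP : (s 0 + 2 / 5 * s 2 - 4 / 5 * s 4) ^+ 2 = 0 by lra.
rewrite sqrf_eq0 => /eqP z0.
have /eqP : (s 3 + (2 / 3) * (s 0 + s 2 + s 4) + 2 * (s 6 + s 7 + s 8)) ^+ 2 = 0 by lra.
rewrite sqrf_eq0 => /eqP z3.
clear h1 h2 h3 h4 h5 h6 h7 h8 sos.
by case=> [|[|[|[|[|[|[|[|[|?]]]]]]]]] // _; lra.
Qed.

(** When s7 = s8 = 0, the squares involving s5 amount, with that of s6, to 3 s5^2 + 4 s5 s6 + 3 s6^2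
    = s5^2 + s6^2 + 2 (s5 + s6)^2. This surplus is what admits cliques of any size at the labels 5
    and 6. *)
Lemma label_sos_ge : s 7 = 0 -> s 8 = 0 -> s 5 ^+ 2 + s 6 ^+ 2 <= label_sos.
Proof.
move=> s7 s8; rewrite /label_sos s7 s8.
have -> : 3 * (s 3 + 2 / 3 * (s 0 + s 2 + s 4) + 2 * (s 6 + 0 + 0)) ^+ 2
  + 5 / 3 * (s 0 + 2 / 5 * s 2 - 4 / 5 * s 4) ^+ 2
  + 7 / 5 * (s 2 - 4 / 7 * s 4) ^+ 2 + 1 / 7 * s 4 ^+ 2
  + 3 * (s 5 + 2 / 3 * (s 6 + 0 + 0)) ^+ 2
  + 5 / 3 * (s 6 - 4 / 5 * (0 + 0)) ^+ 2
  + 3 / 5 * (0 - 2 / 3 * 0) ^+ 2 + 1 / 3 * 0 ^+ 2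
  = s 5 ^+ 2 + s 6 ^+ 2 + (3 * (s 3 + 2 / 3 * (s 0 + s 2 + s 4) + 2 * s 6) ^+ 2
  + 5 / 3 * (s 0 + 2 / 5 * s 2 - 4 / 5 * s 4) ^+ 2
  + 7 / 5 * (s 2 - 4 / 7 * s 4) ^+ 2 + 1 / 7 * s 4 ^+ 2 + 2 * (s 5 + s 6) ^+ 2).
  by field.
by rewrite lerDl !addr_ge0 // mulr_ge0 ?sqr_ge0 //; lra.
Qed.
End Quadratic.

Section LabelForm.
Local Open Scope ring_scope.
Variables (R : rcfType) (G : sgraph) (c : G -> 'I_9).
Hypotheses (G_conn : connected G) (c_lab : labelling c).
Variables (p r : G).
Hypotheses (cp : c p = 1%N :> nat) (cr : c r = 3%N :> nat).
Variable y : G -> R.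

Definition csum (k : nat) : R := \sum_(x | c x == k :> nat) y x.
Definition csqr (k : nat) : R := \sum_(x | c x == k :> nat) y x ^+ 2.

Lemma sum_labels (F : G -> R) :
  \sum_x F x = \sum_(0 <= k < 9) \sum_(x | c x == k :> nat) F x.
Proof. by rewrite big_mkord (partition_big c xpredT). Qed.

(** The value 1 of [ldist] on equal labels makes one formula cover the diagonal too: 1 = 2 - 1. *)
Lemma shifted_dist_label x z :
  shifted_dist R x z = (ldist (c x) (c z))%:R *+ 2 - (x == z)%:R.
Proof.
rewrite /shifted_dist; have [->|xz] := eqVneq x z; last first.
  by rewrite (label_dist G_conn c_lab cp cr) // addr0 subr0.
by rewrite dist_xx /ldist eqxx /=; ring.
Qed.

Lemma label_linear : \sum_z shifted_dist R p z * y z =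
  \sum_(0 <= k < 9) (ldist 1 k)%:R *+ 2 * csum k - y p.
Proof.
transitivity (\sum_z ((ldist 1 (c z))%:R *+ 2 * y z - (p == z)%:R * y z)).
  by apply: eq_bigr => z _; rewrite shifted_dist_label cp mulrBl.
rewrite sumrB; congr (_ - _); last first.
  rewrite (bigD1 p) //= eqxx mul1r big1 ?addr0 // => z /negbTE zp.
  by rewrite eq_sym zp mul0r.
rewrite sum_labels; apply: eq_bigr => k _; rewrite big_distrr /=.
by apply: eq_bigr => z /eqP ->.
Qed.

Lemma dist_form_label : dist_form y y =
  \sum_(0 <= k < 9) \sum_(0 <= l < 9) (ldist k l)%:R *+ 2 * (csum k * csum l)
  - \sum_(0 <= k < 9) csqr k.
Proof.
transitivity (\sum_x (\sum_z ((ldist (c x) (c z))%:R *+ 2 * (y x * y z)) - y x ^+ 2)).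
  apply: eq_bigr => x _.
  rewrite [in RHS](bigD1 x) //= [LHS](bigD1 x) //= addrAC; congr (_ + _).
    by rewrite shifted_dist_label eqxx mulrBl mul1r expr2.
  by apply: eq_bigr => z zx; rewrite shifted_dist_label eq_sym (negbTE zx) subr0.
rewrite sumrB; congr (_ - _); last exact: sum_labels.
rewrite sum_labels; apply: eq_bigr => k _.
transitivity (\sum_(x | c x == k :> nat)
   \sum_(0 <= l < 9) (ldist k l)%:R *+ 2 * (y x * csum l)).
  apply: eq_bigr => x /eqP cx; rewrite sum_labels; apply: eq_bigr => l _.
  by rewrite /csum !big_distrr /=; apply: eq_bigr => z /eqP ->; rewrite cx.
rewrite exchange_big /=; apply: eq_bigr => l _.
by rewrite -big_distrr /= -big_distrl.
Qed.

Lemma csqr_ge0 k : 0 <= csqr k.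
Proof. by apply: sumr_ge0 => x _; rewrite sqr_ge0. Qed.

Lemma csum_empty k : (forall x, c x != k :> nat) -> csum k = 0 /\ csqr k = 0.
Proof. by move=> h; split; apply: big1 => x; rewrite (negbTE (h x)). Qed.

Lemma csum_single k : (forall x z, c x = k :> nat -> c z = k :> nat -> x = z) ->
  csqr k = csum k ^+ 2.
Proof.
move=> h; case: (pickP [pred x | c x == k :> nat]) => [x /= cx|no].
  have e z : (c z == k :> nat) = (z == x).
    by apply/eqP/eqP => [cz|->]; [apply: h => //; apply/eqP | apply/eqP].
  by rewrite /csqr /csum !(eq_bigl _ _ e) !big_pred1_eq.
have [|-> ->] := @csum_empty k; last by rewrite expr0n.
by move=> x; have /= := no x => ->.
Qed.

Lemma csqr_eq0 k : csqr k = 0 -> csum k = 0.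
Proof.
move/eqP; rewrite psumr_eq0 => [/allP h|x _]; last exact: sqr_ge0.
apply: big1 => x cx; have := h x; rewrite mem_index_enum cx => /(_ isT) /=.
by rewrite sqrf_eq0 => /eqP.
Qed.

Lemma csum1 : csum 1 = y p.
Proof.
rewrite /csum (bigD1 p) ?cp //= big1 ?addr0 // => x /andP[/eqP cx /negP[]].
by apply/eqP/(label1_inj c_lab); rewrite ?cx //; apply: ord_inj; rewrite cx cp.
Qed.

Lemma sqr_sum_neq0 : (exists z, y z != 0) -> 0 < \sum_(0 <= k < 9) csqr k.
Proof.
move=> [z yz]; rewrite -[X in _ < X]sum_labels (bigD1 z) //=.
by rewrite ltr_pwDl ?exprn_even_gt0 // sumr_ge0 // => x _; rewrite sqr_ge0.
Qed.

(** On the hyperplane of the row of [p], the form is the sum of the differences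
    [csum k ^+ 2 - csqr k], minus [label_sos csum]. A difference vanishes for a class with at most
    one vertex; for the classes 5 and 6 of a Pt_2 the squares of the sums are absorbed by
    [label_sos_ge]. A nonnegative value would thus annihilate all class sums and all sums of
    squares. *)
Lemma dist_form_label_neg : (exists z, y z != 0) ->
  \sum_z shifted_dist R p z * y z = 0 -> dist_form y y < 0.
Proof.
move=> /sqr_sum_neq0 pos; rewrite label_linear -csum1 -/(label_lin csum) => lin.
rewrite dist_form_label label_quadratic lin expr0n add0r ltNge; apply/negP => F0.
suff zero k : (k < 9)%N -> csum k = 0 /\ csqr k = 0.
  by move: pos; rewrite big_nat big1 ?ltxx // => k /andP[_ /zero[]].
have sing k' : (k' < 5)%N \/ injective c -> csqr k' = csum k' ^+ 2.
  move=> k5; apply: csum_single => x z cx cz.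
  have cxz : c x = c z by apply: ord_inj; rewrite cx cz.
  case: k5 => [k5|inj]; last exact: inj.
  by apply: (label1_inj c_lab); rewrite ?cx.
have sos k' : label_sos csum <= 0 -> (k' < 9)%N -> csum k' = 0.
  by move=> ? ?; apply: label_sos_eq0.
case: (c_lab) => _ [[_ lt7] | inj].
  have [s7 n7] : csum 7 = 0 /\ csqr 7 = 0.
    by apply: csum_empty => x; rewrite ltn_eqF.
  have [s8 n8] : csum 8 = 0 /\ csqr 8 = 0.
    by apply: csum_empty => x; rewrite ltn_eqF // (leq_trans (lt7 x)).
  have le := label_sos_ge s7 s8.
  have := csqr_ge0 5; have := csqr_ge0 6; move: F0.
  rewrite /index_iota /= !big_cons !big_nil s7 s8 n7 n8.
  have s0 := sing 0%N (or_introl isT); have s1 := sing 1%N (or_introl isT).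
  have s2 := sing 2%N (or_introl isT); have s3 := sing 3%N (or_introl isT).
  have s4 := sing 4%N (or_introl isT); rewrite s0 s1 s2 s3 s4 => F0 n60 n50.
  have n5 : csqr 5 = 0 by lra.
  have n6 : csqr 6 = 0 by lra.
  have {}sos k' : (k' < 9)%N -> csum k' = 0.
    apply: sos; move: F0; rewrite n5 n6 (csqr_eq0 n5) (csqr_eq0 n6); lra.
  move=> k9; split; first exact: sos.
  case: k k9 => [|[|[|[|[|[|[|[|[|?]]]]]]]]] // _;
    by rewrite ?s0 ?s1 ?s2 ?s3 ?s4 ?sos ?expr0n.
move=> k9; rewrite sing; last by right.
suff -> : csum k = 0 by rewrite expr0n.
apply: sos => //; move: F0.
have -> : \sum_(0 <= j < 9) csqr j = \sum_(0 <= j < 9) csum j ^+ 2.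
  by apply: eq_bigr => j _; rewrite sing //; right.
lra.
Qed.
End LabelForm.

Theorem labelling_lambda2 (R : rcfType) (G : sgraph) (c : G -> 'I_9) :
  connected G -> diameter G = 3 -> labelling c -> (lambda R G 2 < - (1 / 2))%R.
Proof.
move=> G_conn diam c_lab; have [[p cp] [r cr]] := label_hubs G_conn c_lab diam.
apply: (@lambda2_sufficient _ _ G_conn _ (shifted_dist R p)) => [|y].
  apply/card_gt1P; exists p, r; split => //.
  by apply: contra_eq_neq cp => ->; rewrite cr.
exact: dist_form_label_neg cr _.
Qed.

(** * Forbidden distance matrices *)

Section Elimination.
Local Open Scope ring_scope.

Definition mkmx (T : Type) n (F : nat -> nat -> T) : seq (seq T) :=
  mkseq (fun i => mkseq (F i) n) n.

Definition entry (T : nmodType) (P : seq (seq T)) i j : T := nth 0 (nth [::] P i) j.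

Lemma entry_mkmx (T : nmodType) n (F : nat -> nat -> T) i j :
  (i < n)%N -> (j < n)%N -> entry (mkmx n F) i j = F i j.
Proof. by move=> i_n j_n; rewrite /entry /mkmx !nth_mkseq. Qed.

(* Gaussian elimination, each Schur complement being scaled by its pivot. *)
Fixpoint posdef n (P : seq (seq Z)) : bool :=
  if n is n'.+1 then
    let a := entry P 0 0 in
    if 0 < a then posdef n' (mkmx n' (fun i j =>
      a * entry P i.+1 j.+1 - entry P i.+1 0 * entry P 0 j.+1))
    else false
  else true.

Section PosDef.
Variable R : realFieldType.
(** Entries are binary integers so that [vm_compute] can carry out the eliminations; [ofZ]
    interprets them in [R]. *)
Definition ofZ (z : Z) : R := (int_of_Z z)%:~R.

Lemma ofZD : {morph ofZ : x y / x + y}.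
Proof. by move=> x y; rewrite /ofZ !rmorphD. Qed.

Lemma ofZB : {morph ofZ : x y / x - y}.
Proof. by move=> x y; rewrite /ofZ !rmorphB. Qed.

Lemma ofZM : {morph ofZ : x y / x * y}.
Proof. by move=> x y; rewrite /ofZ !rmorphM. Qed.

Lemma ofZn n : ofZ n%:R = n%:R.
Proof. by rewrite /ofZ !rmorph_nat. Qed.

Lemma ofZ_gt0 z : (0 < ofZ z) = (0 < z).
Proof. rewrite /ofZ ltr0z; case: z => //= z.
by rewrite ltz_nat; have /ssrnat.ltP -> := Pos2Nat.is_pos z.
Qed.

(** Completing the square in the first variable shows that the Schur complement inherits
    positivity. *)
Lemma posdefP n (P : seq (seq Z)) :
  (forall i j, (i < n)%N -> (j < n)%N -> entry P i j = entry P j i) ->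
  (forall x : nat -> R, (exists2 i, (i < n)%N & x i != 0) ->
    0 < \sum_(i < n) \sum_(j < n) ofZ (entry P i j) * (x i * x j)) ->
  posdef n P.
Proof.
elim: n P => //= n IH P sym pos; set a := entry P 0 0.
have a0 : 0 < a.
  have := pos (fun i => (i == 0%N)%:R); rewrite -ofZ_gt0.
  rewrite (bigD1 ord0) //= (bigD1 ord0) //= !big1 => [|i|i].
  - by rewrite !addr0 mulr1 mulr1; apply; exists 0%N; rewrite //= oner_neq0.
  - by case: i => [[|i] ?] //= _; rewrite big1 // => j _; rewrite mul0r mulr0.
  - by case: i => [[|i] ?] //= _; rewrite mulr0 mulr0.
rewrite a0; apply: IH => [i j i_n j_n|x [i i_n xi]].
  rewrite !entry_mkmx // (sym i.+1 j.+1) // (sym i.+1 0%N) // (sym 0%N j.+1) //.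
  by rewrite [X in _ - X = _]mulrC.
set l := \sum_(j < n) ofZ (entry P 0 j.+1) * x j.
(* The first coordinate is chosen to minimise the form; its value there is S - l^2 / a, which [a]
   times equals the form of the scaled Schur complement. *)
pose x' k := if k is k'.+1 then x k' else - l / ofZ a.
have x'0 : exists2 i, (i < n.+1)%N & x' i != 0 by exists i.+1.
have ra : 0 < ofZ a by rewrite ofZ_gt0.
have := pos _ x'0; rewrite -(pmulr_rgt0 _ ra); congr (_ < _).
set S := \sum_(i < n) \sum_(j < n) ofZ (entry P i.+1 j.+1) * (x i * x j).
have rowE k : (k < n)%N -> \sum_(j < n.+1) ofZ (entry P k.+1 j) * (x' k.+1 * x' j)
    = - l / ofZ a * (ofZ (entry P 0 k.+1) * x k)
      + \sum_(j < n) ofZ (entry P k.+1 j.+1) * (x k * x j).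
  by move=> k_n; rewrite big_ord_recl (sym k.+1 0%N) //=; congr (_ + _); ring.
have -> : \sum_(i < n.+1) \sum_(j < n.+1) ofZ (entry P i j) * (x' i * x' j)
    = S - l ^+ 2 / ofZ a.
  rewrite big_ord_recl (eq_bigr (fun k : 'I_n => - l / ofZ a *
    (ofZ (entry P 0 k.+1) * x k) +
    \sum_(j < n) ofZ (entry P k.+1 j.+1) * (x k * x j))); last first.
    by move=> k _; apply: rowE.
  rewrite big_split -big_distrr -/l -/S big_ord_recl /= -/a.
  rewrite (eq_bigr (fun k : 'I_n => - l / ofZ a *
    (ofZ (entry P 0 k.+1) * x k))); last by move=> k _; rewrite /bump /=; ring.
  rewrite -big_distrr -/l /=; field; exact: lt0r_neq0.
transitivity (ofZ a * S - l * l); first by field; exact: lt0r_neq0.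
have -> : l * l = \sum_(k < n) \sum_(j < n)
    ofZ (entry P k.+1 0 * entry P 0 j.+1) * (x k * x j).
  rewrite big_distrl; apply: eq_bigr => k _; rewrite big_distrr.
  by apply: eq_bigr => j _ /=; rewrite ofZM (sym k.+1 0%N (ltn_ord k) isT); ring.
rewrite big_distrr -sumrB; apply: eq_bigr => k _.
rewrite big_distrr -sumrB; apply: eq_bigr => j _ /=.
by rewrite entry_mkmx // ofZB !ofZM; ring.
Qed.
End PosDef.

End Elimination.

(** * Distance matrices compatible with lambda_2 < -1/2 *)

Section Feasibility.
Local Open Scope ring_scope.

Definition dentry (D : seq (seq nat)) i j : nat := nth 0%N (nth [::] D i) j.

Definition shifted (D : seq (seq nat)) i j : Z :=
  (dentry D i j)%:R *+ 2 + (i == j)%:R.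

(* The first diagonal entry of 2D + I is 1, so the negative of its Schur
   complement is integral; 2D + I has a single nonnegative eigenvalue iff this
   matrix is positive definite. *)
Definition hyperbolic (D : seq (seq nat)) : bool :=
  posdef (size D).-1 (mkmx (size D).-1 (fun i j =>
    shifted D 0 i.+1 * shifted D 0 j.+1 - shifted D i.+1 j.+1)).

Definition triangular (D : seq (seq nat)) : bool :=
  let I := iota 0 (size D) in
  all (fun i => all (fun j => all (fun k =>
    dentry D i j <= dentry D i k + dentry D k j)%N I) I) I.

(** The [if], in place of a conjunction, lets [vm_compute] skip the elimination when the triangle
    inequality fails. *)
Definition feasible D := if triangular D then hyperbolic D else false.

Definition dmat (G : sgraph) (vs : seq G) : seq (seq nat) :=
  [seq [seq dist x y | y <- vs] | x <- vs].

Section Feasible.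
Variables (R : rcfType) (G : sgraph).
Hypotheses (G_conn : connected G) (lam : lambda R G 2 < - (1 / 2)).

Lemma dentry_dmat (x0 : G) vs i j : (i < size vs)%N -> (j < size vs)%N ->
  dentry (dmat vs) i j = dist (nth x0 vs i) (nth x0 vs j).
Proof.
move=> i_n j_n; rewrite /dentry /dmat (nth_map x0) //.
by rewrite (nth_map x0).
Qed.

Lemma sum_support (vs : seq G) (F : G -> R) : uniq vs ->
  (forall z, z \notin vs -> F z = 0) -> \sum_z F z = \sum_(z <- vs) F z.
Proof.
move=> u0 F0; rewrite [RHS]big_uniq //= (bigID (mem vs)) /=.
by rewrite [X in _ + X]big1 ?addr0.
Qed.

(** A vector on the tail of the list is extended by 0 outside the list and, at its head [b], by the
    value [yb] making it orthogonal to the indicator of [b]. Its value under the form of 2D + I is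
    then minus its value under the matrix tested by [hyperbolic]. *)
Lemma dmat_hyperbolic (vs : seq G) : uniq vs -> hyperbolic (dmat vs).
Proof.
case: vs => [//|b ws] /= /andP[bws uws].
rewrite /hyperbolic size_map /=; set n := size ws.
have M0 i : (i < n)%N -> ofZ R (shifted (dmat (b :: ws)) 0 i.+1) =
    shifted_dist R b (nth b ws i).
  move=> i_n; rewrite /shifted (dentry_dmat b) //= /shifted_dist ofZD /=.
  have /negbTE -> : b != nth b ws i.
    by apply: contraNneq bws => ->; apply: mem_nth.
  by rewrite -mulr_natl ofZM !ofZn mulr_natl.
have M1 i j : (i < n)%N -> (j < n)%N ->
    ofZ R (shifted (dmat (b :: ws)) i.+1 j.+1) =
        shifted_dist R (nth b ws i) (nth b ws j).
  move=> i_n j_n; rewrite /shifted (dentry_dmat b) //= /shifted_dist ofZD eqSS.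
  by rewrite nth_uniq // -mulr_natl ofZM !ofZn mulr_natl.
have gMC (x z : G) : shifted_dist R x z =
    shifted_dist R z x by rewrite /shifted_dist (dist_sym G_conn) (eq_sym x).
apply: (@posdefP R) => [i j i_n j_n|x [i0 i0_n xi0]].
  rewrite !entry_mkmx // mulrC; congr (_ - _).
  by rewrite /shifted !(dentry_dmat b) // (dist_sym G_conn) (eq_sym i.+1).
pose yb := - \sum_(i < n) shifted_dist R b (nth b ws i) * x i.
pose y z := if z == b then yb else if z \in ws then x (index z ws) else 0.
have y_b : y b = yb by rewrite /y eqxx.
have y_w i : (i < n)%N -> y (nth b ws i) = x i.
  move=> i_n; rewrite /y mem_nth // index_uniq //; case: eqP => // e.
  by rewrite -e mem_nth in bws.
have sumE (F : G -> R) :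
    \sum_z F z * y z = F b * yb + \sum_(i < n) F (nth b ws i) * x i.
  rewrite (@sum_support (b :: ws)) /= ?bws //; last first.
    move=> z; rewrite inE negb_or /y => /andP[/negbTE -> /negbTE ->].
    by rewrite mulr0.
  rewrite big_cons y_b; congr (_ + _); rewrite (big_nth b) big_mkord.
  by apply: eq_bigr => i _; rewrite y_w.
have yl : \sum_z shifted_dist R b z * y z = 0.
  by rewrite sumE /shifted_dist dist_xx eqxx mul0rn add0r mul1r addNr.
have := lambda2_necessary G_conn _ lam yl.
have -> : dist_form y y = \sum_z (\sum_t shifted_dist R z t * y t) * y z.
  apply: eq_bigr => z _; rewrite big_distrl; apply: eq_bigr => t _ /=.
  by ring.
rewrite sumE yl mul0r add0r.
have -> : \sum_(i < n) (\sum_t shifted_dist R (nth b ws i) t * y t) * x i =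
  - \sum_(i < n) \sum_(j < n) ofZ R (entry (mkmx n (fun i j =>
    shifted (dmat (b :: ws)) 0 i.+1 * shifted (dmat (b :: ws)) 0 j.+1
    - shifted (dmat (b :: ws)) i.+1 j.+1)) i j) * (x i * x j).
  rewrite -sumrN; apply: eq_bigr => i _; rewrite sumE mulrDl.
  rewrite /yb mulrN mulNr mulr_sumr !mulr_suml -!sumrN -big_split /=.
  apply: eq_bigr => j _.
  rewrite entry_mkmx // ofZB ofZM !M0 // M1 // (gMC (nth b ws i) b); ring.
rewrite oppr_lt0; apply.
  by apply/card_gt1P; exists b, (nth b ws i0); split => //;
     apply: contraNneq bws => ->; apply: mem_nth.
by exists (nth b ws i0); rewrite y_w.
Qed.

Lemma dmat_feasible (vs : seq G) : uniq vs -> feasible (dmat vs).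
Proof.
move=> u0; rewrite /feasible dmat_hyperbolic // (_ : triangular _ =
    true) // /triangular size_map.
case: vs u0 => [//|b ws] u0.
apply/allP => i; rewrite mem_iota => i_n; apply/allP => j; rewrite mem_iota => j_n.
apply/allP => k; rewrite mem_iota => k_n.
by rewrite !(dentry_dmat b) //; apply: dist_tri.
Qed.

Definition extend (D : seq (seq nat)) (r : seq nat) : seq (seq nat) :=
  rcons [seq rcons x.1 x.2 | x <- zip D r] (rcons r 0%N).

Lemma dmat_rcons (vs : seq G) w :
  dmat (rcons vs w) = extend (dmat vs) [seq dist v w | v <- vs].
Proof.
rewrite /dmat /extend map_rcons; congr rcons; last first.
  by rewrite map_rcons dist_xx; congr rcons; apply: eq_map => v; rewrite dist_sym.
rewrite zip_map -map_comp /=.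
by apply: eq_map => v /=; rewrite map_rcons.
Qed.

(** The candidate rows of a further vertex, whose distances to the given ones are 1, 2 or 3 when the
    diameter is 3. *)
Fixpoint dist_seqs n : seq (seq nat) :=
  if n is n'.+1 then [seq d :: r | d <- [:: 1; 2; 3]%N, r <- dist_seqs n']
  else [:: [::]].

Hypothesis diam : diameter G = 3%N.

Lemma dist_in (x y : G) : x != y -> dist x y \in [:: 1; 2; 3]%N.
Proof.
rewrite -(dist_gt0 G_conn); have := dist_diam x y; rewrite diam.
by case: (dist x y) => [|[|[|[|?]]]].
Qed.

Lemma dist_seqs_mem (vs : seq G) w : w \notin vs ->
  [seq dist v w | v <- vs] \in dist_seqs (size vs).
Proof.
elim: vs => // v vs IH; rewrite inE negb_or => /andP[wv wvs].
apply/allpairsP; exists (dist v w, [seq dist v w | v <- vs]); split => //=.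
  by rewrite dist_in // eq_sym.
exact: IH.
Qed.

Lemma extension_row (vs : seq G) (D : seq (seq nat)) w :
  dmat vs = D -> uniq (rcons vs w) ->
  [seq dist v w | v <- vs] \in [seq r <- dist_seqs (size vs) | feasible (extend D r)].
Proof.
move=> <- u0; rewrite mem_filter -dmat_rcons dmat_feasible // dist_seqs_mem //.
by move: u0; rewrite rcons_uniq => /andP[].
Qed.
End Feasible.

End Feasibility.

(** * Necessity *)

Definition diamond_in (G : sgraph) (p r o t : G) : Prop :=
  [/\ adj p r, adj p o /\ adj p t, adj r o /\ adj r t, o != t & ~~ adj o t].

Definition cherry : seq (seq nat) := [:: [:: 0; 1; 1]; [:: 1; 0; 2]; [:: 1; 2; 0]].

Definition completions (D : seq (seq nat)) : seq (seq nat) :=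
  [seq r <- dist_seqs (size D) | feasible (extend D r)].

(** The cherry is an induced path k, c, k' listed as c, k, k'. Here [r1] is the row of a vertex z
    nearer to k than to c, and [r2] that of a vertex w nearer to k' than to c, its last entry being
    the distance from z to w. The condition on [r1] alone serves the case w = k', and
    [cherry_neighbours] the case z = k. *)
Lemma cherry_sides :
  all (fun r1 => (nth 0 r1 0 == (nth 0 r1 1).+1) ==>
    (nth 0 r1 2 != 1) &&
    all (fun r2 => ~~ ((nth 0 r2 0 == (nth 0 r2 2).+1) && (nth 0 r2 3 == 1)))
        (completions (extend cherry r1)))
  (completions cherry).
Proof. by vm_compute. Qed.

Lemma cherry_neighbours :
  all (fun r2 => ~~ ((nth 0 r2 0 == (nth 0 r2 2).+1) && (nth 0 r2 1 == 1)))
      (completions cherry).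
Proof. by vm_compute. Qed.

Section Structure.
Variables (R : rcfType) (G : sgraph).
Hypotheses (G_conn : connected G) (lam : (lambda R G 2 < - (1 / 2))%R).
Hypothesis diam : diameter G = 3.

Lemma dmat_completion (vs : seq G) D w :
  dmat vs = D -> uniq vs -> w \notin vs ->
  [seq dist v w | v <- vs] \in completions D.
Proof.
move=> <- uvs wvs; rewrite /completions size_map.
by apply: (@extension_row R) => //; rewrite rcons_uniq wvs.
Qed.

Lemma adj_dist (x y : G) : adj x y -> (dist x y = 1) * (dist y x = 1).
Proof. by move=> xy; split; apply/eqP; rewrite dist1 // adj_sym. Qed.

Lemma common_dist (x y z : G) : x != y -> ~~ adj x y -> adj x z -> adj y z ->
  (dist x y = 2) * (dist y x = 2).
Proof.
move=> xy nxy xz yz; have d : dist x y = 2.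
  by apply/eqP/dist2P => //; split=> //; exists z; rewrite // adj_sym.
by rewrite (dist_sym G_conn y).
Qed.

Lemma cherry_dmat (c k k' : G) : adj c k -> adj c k' -> k != k' -> ~~ adj k k' ->
  dmat [:: c; k; k'] = cherry.
Proof.
move=> ck ck' kk nkk; rewrite /dmat /= !dist_xx !(adj_dist ck) !(adj_dist ck').
by rewrite !(common_dist kk nkk (z := c)) // adj_sym.
Qed.

(** An edge from z to w would close a walk through k, c and k'. Only the distances among these five
    vertices matter, so walks of any length are excluded by matrices of order at most 5. *)
Lemma cherry_side (c k k' z w : G) :
  adj c k -> adj c k' -> k != k' -> ~~ adj k k' ->
  dist c z = (dist k z).+1 -> dist c w = (dist k' w).+1 -> z != c -> w != c ->
  ~~ adj z w.
Proof.
move=> ck ck' kk nkk cz cw zc wc; apply/negP => zw.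
have ckn : c != k by apply: (@adj_neq G).
have ckn' : c != k' by apply: (@adj_neq G).
have u3 : uniq [:: c; k; k'] by rewrite /= !inE negb_or ckn ckn' kk.
have D3 := cherry_dmat ck ck' kk nkk.
have wk : w != k.
  apply: contraNneq nkk => wk; move: cw; rewrite wk (adj_dist ck) => -[/esym/eqP].
  by rewrite dist0 // eq_sym (negbTE kk).
have [wk'|wk'] := eqVneq w k'.
  have [zk|zk] := eqVneq z k; first by move: zw; rewrite zk wk' (negbTE nkk).
  have zk' : z != k' by rewrite -wk'; apply: (@adj_neq G).
  have z3 : z \notin [:: c; k; k'] by rewrite !inE !negb_or zc zk zk'.
  have := allP cherry_sides _ (dmat_completion D3 u3 z3).
  by rewrite /= cz eqxx /= -wk' (adj_dist zw) eqxx.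
have w3 : w \notin [:: c; k; k'] by rewrite !inE !negb_or wc wk wk'.
have [zk|zk] := eqVneq z k.
  have := allP cherry_neighbours _ (dmat_completion D3 u3 w3).
  by rewrite /= cw eqxx -zk (adj_dist zw).
have zk' : z != k'.
  apply: contraNneq nkk => zk'; move: cz; rewrite zk' (adj_dist ck') => -[/esym/eqP].
  by rewrite dist0 // (negbTE kk).
have z3 : z \notin [:: c; k; k'] by rewrite !inE !negb_or zc zk zk'.
have := allP cherry_sides _ (dmat_completion D3 u3 z3).
rewrite [nth _ _ _ == _]/= cz eqxx => /andP[_ /allP h].
have D4 : dmat [:: c; k; k'; z] = extend cherry [seq dist v z | v <- [:: c; k; k']].
  by rewrite -D3 -dmat_rcons.
have u4 : uniq [:: c; k; k'; z] by rewrite -[_ :: _]/(rcons [:: c; k;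
    k'] z) rcons_uniq z3.
have w4 : w \notin [:: c; k; k'; z].
  by rewrite !inE !negb_or wc wk wk' eq_sym (@adj_neq G).
have := h _ (dmat_completion D4 u4 w4).
by rewrite /= cw eqxx (adj_dist zw) eqxx.
Qed.

(* Let a, b be nonadjacent neighbours of a vertex c in a block.  Unless there is
   a diamond, the neighbours of c which are equal or adjacent to a form a clique,
   and by [cherry_side] the vertices nearer to this clique than to c are closed
   under adjacency in G - c; so c separates a from b. *)
Lemma diamond_exists : ~~ block_graph G -> exists p r o t : G, diamond_in p r o t.
Proof.
rewrite negb_forall => /existsP[B]; rewrite negb_imply inE => /andP[/maxsetP[Bns _]].
case/and3P: Bns => _ Bconn /forallP Bcut.
rewrite negb_forall => /existsP[x]; rewrite negb_imply => /andP[xB].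
rewrite negb_forall => /existsP[y]; rewrite negb_imply => /andP[yB].
rewrite negb_imply => /andP[xy nxy].
(* [a] is x, and [b] is the first vertex neither equal nor adjacent to x on a path of [B] from x to
   y. *)
have [a [c [b [aB cB bB [ac cb ab nab]]]]] : exists a c b : G,
   [/\ a \in B, c \in B, b \in B & [/\ adj a c, adj c b, a != b & ~~ adj a b]].
  have /forall_inP/(_ _ yB)/connectP[q0] := forall_inP Bconn _ xB.
  suff H q z : (z == x) || adj x z ->
      path [rel u v | [&& u \in B, v \in B & adj u v]] z q -> y = last z q ->
      exists a c b : G,
        [/\ a \in B, c \in B, b \in B & [/\ adj a c, adj c b, a != b & ~~ adj a b]].
    by apply: H; rewrite eqxx.
  elim: q z => [|w q IH] z zx /=.
    move=> _ yz; rewrite -yz in zx; case/orP: zx => e.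
      by rewrite eq_sym e in xy.
    by rewrite e in nxy.
  case/andP=> /and3P[zB wB zw] qp yq.
  case: (boolP ((w == x) || adj x w)) => [wx|]; first exact: IH qp yq.
  rewrite negb_or eq_sym => /andP[xw nxw]; exists x, z, w; split=> //; split=> //.
  by case/orP: zx => [/eqP zx|//]; rewrite -zx zw in nxw.
have cc : ~~ cut_vertex B c := Bcut c.
move: cc; rewrite /cut_vertex cB /= negbK => /forall_inP/(_ a).
rewrite !inE (@adj_neq G) // aB => /(_ isT)/forall_inP/(_ b).
rewrite !inE eq_sym (@adj_neq G) // bB => /(_ isT)/connectP[q qp bq].
pose side z := [exists k, [&& adj c k, (k == a) || adj k a & dist k z < dist c z]].
(* Such [k] and [k'] give a diamond with hubs [c], [k] and further vertices [a], [k']. *)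
case: (boolP [exists k, exists k',
   [&& adj c k, (k == a) || adj k a, adj c k', k' != a, ~~ adj k' a & adj k k']]).
  case/existsP=> k /existsP[k' /and5P[ck ka ck' k'a /andP[nk'a kk']]].
  case/orP: ka => [/eqP ka|ka]; first by rewrite -ka adj_sym kk' in nk'a.
  exists c, k, a, k'; split.
  - by [].
  - by split=> //; rewrite adj_sym.
  - by [].
  - by rewrite eq_sym.
  - by rewrite adj_sym.
rewrite negb_exists => /forallP no_dia.
have {}no_dia k k' : adj c k -> (k == a) || adj k a -> adj c k' ->
    ~~ ((k' == a) || adj k' a) -> ~~ adj k k' /\ k != k'.
  move=> ck ka ck' k'a; split; last by apply: contraNneq k'a => <-.
  move: (no_dia k); rewrite negb_exists => /forallP/(_ k').
  by move: k'a; rewrite negb_or ck ka ck' => /andP[-> ->].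
have closed z w : z != c -> w != c -> adj z w -> side z -> side w.
  move=> zc wc zw /existsP[k /and3P[ck ka kz]].
  have cz : dist c z = (dist k z).+1.
    apply/eqP; rewrite eqn_leq kz andbT.
    by have := dist_tri G_conn c k z; rewrite (adj_dist ck).
  (* [k'] is the first vertex after [c] on a shortest path from [c] to [w]. *)
  have [k' ck' cw] : exists2 k', adj c k' & dist c w = (dist k' w).+1.
    have [[|k' p] [cp pw pd]] := dist_path G_conn c w.
      by move: wc; rewrite -pw eqxx.
    case/andP: cp => ck' kp; exists k' => //; apply/eqP.
    have le : dist k' w <= size p by rewrite -pw; apply: dist_le.
    rewrite eqn_leq -[X in _ && (_ < X)]pd /= ltnS le andbT.
    by have := dist_tri G_conn c k' w; rewrite (adj_dist ck').
  apply/existsP; exists k'; rewrite ck' cw ltnS leqnn andbT /=.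
  apply/negPn/negP => k'a; have [nkk kk] := no_dia k k' ck ka ck' k'a.
  by move/negP: (cherry_side ck ck' kk nkk cz cw zc wc); apply.
have : side b.
  have : side a by apply/existsP; exists a;
      rewrite eqxx adj_sym ac dist_xx dist_gt0 //= (@adj_neq G) // adj_sym.
  have : a != c by apply: (@adj_neq G).
  rewrite bq; elim: q (a) qp {bq} => //= w q IH z /andP[/and3P[_ wB zw] qp] zc zs.
  have wc : w != c by move: wB; rewrite !inE => /andP[].
  by apply: IH => //; apply: closed zs.
(* As [b] is adjacent to [c], only [b] itself is nearer to [b] than [c]; so [k] is [b], which is
   neither equal nor adjacent to [a]. *)
case/existsP => k /and3P[ck ka].
rewrite (adj_dist cb) ltnS leqn0 dist0 // => /eqP kb.
by move: ka; rewrite kb eq_sym (negbTE ab) adj_sym (negbTE nab).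
Qed.
End Structure.

(** * Vertices outside a diamond *)

Definition diamond_mx : seq (seq nat) :=
  [:: [:: 0; 1; 1; 1]; [:: 1; 0; 1; 1]; [:: 1; 1; 0; 2]; [:: 1; 1; 2; 0]].
(* Rows of distances to [p], [r], [o], [t], in the order of [diamond_mx]. *)
Local Notation typeQ := [:: 1; 1; 1; 2].
Local Notation typeQ' := [:: 1; 1; 2; 1].
Local Notation typeP := [:: 1; 2; 2; 2].
Local Notation typeR := [:: 2; 1; 2; 2].
Local Notation near_rows := [:: typeQ; typeQ'; typeP; typeR].
Local Notation far_rows := [:: [:: 2; 2; 2; 3]; [:: 2; 2; 3; 2];
  [:: 2; 2; 3; 3]; [:: 2; 3; 3; 3]; [:: 3; 2; 3; 3]].

Lemma diamond_rows : completions diamond_mx = near_rows ++ far_rows.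
Proof. by vm_compute. Qed.

(** The first clause will empty [far_rows] by connectedness. The second makes the further common
    neighbour of the hubs unique. The third and fourth exclude edges between vertices of different
    types. *)
Definition compatible (r1 r2 : seq nat) (d : nat) : bool :=
  [&& (d == 1) && (r1 \in near_rows) ==> (r2 \in near_rows),
      ~~ ((r1 \in [:: typeQ; typeQ']) && (r2 \in [:: typeQ; typeQ'])),
      (r1 == typeP) && (r2 == typeR) ==> (d == 3),
      (r1 == typeQ) && (r2 \in [:: typeP; typeR]) ==> (d == 2) &
      (r1 == r2) && (r1 \in [:: typeP; typeR]) ==> (d <= 2)].

Lemma diamond_pairs :
  all (fun r1 => all (fun r2 => all (fun d =>
      feasible (extend (extend diamond_mx r1) (rcons r2 d)) ==> compatible r1 r2 d)
    [:: 1; 2; 3]) (near_rows ++ far_rows)) (near_rows ++ far_rows).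
Proof. by vm_compute. Qed.

(* The diamond with two nonadjacent vertices of type R and one of type P. *)
Definition split_mx : seq (seq nat) :=
  extend (extend (extend diamond_mx typeR) (rcons typeR 2)) (typeP ++ [:: 3; 3]).

(** In Pt_1 only s is attached to p alone, while x, y, z are attached to r alone and span the single
    edge yz. This table and the next two force that picture: no second vertex of type P, a third
    vertex of type R adjacent to exactly one of the two given ones, and no fourth. *)
Lemma split_typeP : all (fun d => ~~ feasible (extend split_mx (typeP ++ [:: 3; 3; d])))
  [:: 1; 2; 3].
Proof. by vm_compute. Qed.

Lemma split_R : all (fun d => all (fun e =>
    feasible (extend split_mx (typeR ++ [:: d; e; 3])) ==> ((d == 1) (+) (e == 1)))
  [:: 1; 2; 3]) [:: 1; 2; 3].
Proof. by vm_compute. Qed.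

Definition split_R2 d e : bool :=
  let D := extend split_mx (typeR ++ [:: d; e; 3]) in
  if feasible D then
    all (fun d' => all (fun e' => all (fun f =>
      ~~ feasible (extend D (typeR ++ [:: d'; e'; 3; f])))
    [:: 1; 2; 3]) [:: 1; 2; 3]) [:: 1; 2; 3]
  else true.

Lemma split_RR : all (fun d => all (split_R2 d) [:: 1; 2; 3]) [:: 1; 2; 3].
Proof. by vm_compute. Qed.

Section Types.
Variables (R : rcfType) (G : sgraph).
Hypotheses (G_conn : connected G) (lam : (lambda R G 2 < - (1 / 2))%R).
Hypothesis diam : diameter G = 3.

Section OneDiamond.
Variables p r o t : G.
Hypothesis dia : diamond_in p r o t.
Let base : seq G := [:: p; r; o; t].
Definition drow (w : G) : seq nat := [seq dist v w | v <- [:: p; r; o; t]].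

Lemma diamond_uniq : uniq base.
Proof.
case: dia => pr [po pt] [ro rt] ot _.
by rewrite /= !inE !negb_or ot !(@adj_neq G).
Qed.

Lemma diamond_dmat : dmat base = diamond_mx.
Proof.
case: dia => pr [po pt] [ro rt] ot not_.
rewrite /dmat /= !dist_xx !(adj_dist G_conn pr) !(adj_dist G_conn po)
    !(adj_dist G_conn pt).
rewrite !(adj_dist G_conn ro) !(adj_dist G_conn rt).
by rewrite !(common_dist G_conn ot not_ (z := p)) // adj_sym.
Qed.

Lemma drow_types w : w \notin base -> drow w \in near_rows ++ far_rows.
Proof.
by rewrite -diamond_rows; apply: (dmat_completion G_conn lam diam diamond_dmat
    diamond_uniq).
Qed.

Lemma dmat_rcons_feasible (vs : seq G) w : uniq (rcons vs w) ->
  feasible (extend (dmat vs) [seq dist v w | v <- vs]).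
Proof. by move=> u; rewrite -dmat_rcons //; apply: (dmat_feasible G_conn lam). Qed.

Lemma drow_compatible z w : z \notin base -> w \notin base -> z != w ->
  compatible (drow z) (drow w) (dist z w).
Proof.
move=> zb wb zw.
have := allP diamond_pairs _ (drow_types zb) => /allP/(_ _ (drow_types wb)).
move/allP/(_ _ (dist_in G_conn diam zw))/implyP; apply.
rewrite -diamond_dmat -dmat_rcons //.
have -> : rcons (drow w) (dist z w) = [seq dist v w | v <- rcons base z].
  by rewrite map_rcons.
apply: dmat_rcons_feasible; rewrite !rcons_uniq zb diamond_uniq !andbT.
by rewrite mem_rcons inE negb_or eq_sym zw wb.
Qed.

Lemma far_not_adj w x : drow w \in far_rows -> x \in base -> ~~ adj x w.
Proof.
move=> wf xb; rewrite -(dist1 G_conn).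
have : dist x w \in drow w by apply: (map_f (fun v => dist v w) xb).
by apply: contraTneq => ->; move: (drow w) wf; apply/allP.
Qed.

(** The diamond and the near vertices together are closed under adjacency: a far row has no entry 1,
    and [compatible] forbids edges from near to far vertices. Connectedness does the rest. *)
Lemma drow_near w : w \notin base -> drow w \in near_rows.
Proof.
move=> wb.
pose N z := (z \in base) || (drow z \in near_rows).
suff : N w by rewrite /N (negbTE wb).
have step z u : adj z u -> N z -> N u.
  rewrite /N => zu; case: (boolP (u \in base)) => //= ub.
  case: (boolP (z \in base)) => [zb _|zb /= zn].
    have := drow_types ub; rewrite mem_cat => /orP[//|uf].
    by have := far_not_adj uf zb; rewrite zu.
  have := drow_compatible zb ub (adj_neq zu).
  by rewrite (adj_dist G_conn zu) => /and5P[]; rewrite eqxx zn.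
have -> : N w = N p; last by rewrite /N inE eqxx.
apply: (@connected_invariant G G_conn _ N) => x y xy.
by apply/idP/idP; apply: step; rewrite // adj_sym.
Qed.
End OneDiamond.

Lemma diamond_swap_ot (p r o t : G) : diamond_in p r o t -> diamond_in p r t o.
Proof. by case=> pr [po pt] [ro rt] ot no; split=> //; rewrite 1?eq_sym 1?adj_sym. Qed.

Lemma diamond_swap_pr (p r o t : G) : diamond_in p r o t -> diamond_in r p o t.
Proof. by case=> pr [po pt] [ro rt] ot no; split=> //; rewrite adj_sym. Qed.

Lemma drowE (p r o t w : G) :
  drow p r o t w = [:: dist p w; dist r w; dist o w; dist t w].
Proof. by []. Qed.

(* A vertex adjacent to [p], [r] and one of [o], [t] is unique, so up to
   exchanging [o] and [t] it is adjacent to [o]. *)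
Lemma oriented_diamond (p r o t : G) : diamond_in p r o t ->
  exists o' t', diamond_in p r o' t' /\
    forall w, w \notin [:: p; r; o'; t'] ->
      drow p r o' t' w \in [:: typeQ; typeP; typeR].
Proof.
move=> dia.
case: (pickP [pred w | (w \notin [:: p; r; o;
    t]) && (drow p r o t w == typeQ')]) => [q|noq].
  case/andP=> qb /eqP qQ; exists t, o; split; first exact: diamond_swap_ot.
  have e w : (w \in [:: p; r; t; o]) = (w \in [:: p; r; o; t]).
    by rewrite !inE [(w == t) || _]orbC.
  move=> w; rewrite e => wb; have := drow_near dia wb.
  have [->|wq] := eqVneq w q.
    by move: qQ; rewrite !drowE => -[-> -> -> ->].
  have := drow_compatible dia qb wb; rewrite eq_sym wq => /(_ isT)/and5P[_ + _ _ _].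
  rewrite qQ !drowE; move: (dist p w) (dist r w) (dist o w) (dist t w) => a b c d.
  rewrite /= !inE => /norP[/eqP nQ /eqP nQ'] /or4P[] /eqP.
  - by move/nQ.
  - by move/nQ'.
  - by case=> -> -> -> ->.
  - by case=> -> -> -> ->.
exists o, t; split=> // w wb; have := drow_near dia wb.
rewrite !inE => /or4P[] e; rewrite ?e ?orbT //.
by have := noq w; rewrite /= wb e.
Qed.
End Types.

(** The rows of the vertices o, p, q, r, t, s, x of Pt_1 in this order, so that the position of a
    row is the label. *)
Definition type_rows : seq (seq nat) :=
  [:: [:: 1; 1; 0; 2]; [:: 0; 1; 1; 1]; typeQ; [:: 1; 0; 1; 1]; [:: 1; 1; 2; 0];
      typeP; typeR].

Section Labels.
Variables (R : rcfType) (G : sgraph).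
Hypotheses (G_conn : connected G) (lam : (lambda R G 2 < - (1 / 2))%R).
Hypothesis diam : diameter G = 3.

Section Oriented.
Variables p r o t : G.
Hypothesis dia : diamond_in p r o t.
Hypothesis ori : forall w, w \notin [:: p; r; o; t] ->
  drow p r o t w \in [:: typeQ; typeP; typeR].
Local Notation row := (drow p r o t).
Definition type_label (w : G) : nat := index (row w) type_rows.
Local Notation lab := type_label.

Lemma base_rows : [/\ row p = [:: 0; 1; 1; 1], row r = [:: 1; 0; 1; 1],
  row o = [:: 1; 1; 0; 2] & row t = [:: 1; 1; 2; 0]].
Proof.
have := diamond_dmat G_conn dia; rewrite /dmat /= !drowE => -[].
by do 16!move=> ->.
Qed.

Lemma base_labels : [/\ lab p = 1, lab r = 3, lab o = 0 & lab t = 4].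
Proof. by case: base_rows; rewrite /lab => -> -> -> ->. Qed.

Lemma label_type w : w \notin [:: p; r; o; t] ->
  [\/ row w = typeQ /\ lab w = 2, row w = typeP /\ lab w = 5
    | row w = typeR /\ lab w = 6].
Proof.
move/ori; rewrite /lab !inE => /or3P[] /eqP ->.
- exact: Or31.
- exact: Or32.
- exact: Or33.
Qed.

Local Opaque type_label.

Lemma label_base w : w \in [:: p; r; o; t] -> lab w \in [:: 0; 1; 3; 4].
Proof.
by case: base_labels => lp lr lo lt; rewrite !inE => /or4P[] /eqP->;
    rewrite ?lp ?lr ?lo ?lt.
Qed.

Lemma base_adj x z : x \in [:: p; r; o; t] -> x != z ->
  (adj x z = ladj (lab x) (lab z)) /\ lab x <> lab z.
Proof.
move=> xb xz; case: (base_labels) (base_rows) => lp lr lo lt [rp rr ro rt].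
have dxz : adj x z = (dist x z == 1) by rewrite dist1.
have d0 : dist x z != 0 by rewrite dist0.
move: dxz d0 xb; case: (boolP (z \in [:: p; r; o; t])) => [zb|zb].
  move=> -> + xb; move: rp rr ro rt; rewrite !drowE => -[p1 p2 p3 p4] [r1 r2 r3 r4].
  move=> [o1 o2 o3 o4] [t1 t2 t3 t4]; move: zb xb; rewrite !inE.
  by case/or4P => /eqP -> /or4P[] /eqP ->; rewrite ?lp ?lr ?lo ?lt ?p1 ?p2 ?p3 ?p4
    ?r1 ?r2 ?r3 ?r4 ?o1 ?o2 ?o3 ?o4 ?t1 ?t2 ?t3 ?t4.
move=> -> _; rewrite !inE; case: (label_type zb); rewrite !drowE => -[[z1 z2 z3 z4] lz];
  by case/or4P => /eqP ->; rewrite ?z1 ?z2 ?z3 ?z4 lz ?lp ?lr ?lo ?lt.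
Qed.

Lemma type_label_nonadj x z : x \notin [:: p; r; o; t] -> z \notin [:: p; r; o; t] ->
  x != z -> lab x != lab z -> ~~ adj x z /\ ~~ ladj (lab x) (lab z).
Proof.
move=> xb zb xz lxz; rewrite -dist1 //.
have zx : z != x by rewrite eq_sym.
have C1 := drow_compatible G_conn lam diam dia xb zb xz.
have C2 := drow_compatible G_conn lam diam dia zb xb zx.
move: lxz C1 C2; rewrite (dist_sym G_conn z).
case: (label_type xb) => -[-> ->]; case: (label_type zb) => -[-> ->] // _;
  by case: (dist x z) => [|[|d]] //=.
Qed.

Lemma same_label x z : lab x = lab z -> x = z \/ 4 < lab x.
Proof.
move=> e; have [->|xz] := eqVneq x z; first by left.
case: (boolP (x \in [:: p; r; o; t])) => [xb|xb].
  by have [_ []] := base_adj xb xz.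
case: (boolP (z \in [:: p; r; o; t])) => [zb|zb].
  by rewrite eq_sym in xz; have [_ []] := base_adj zb xz.
have [[rx lx]|[_ lx]|[_ lx]] := label_type xb; last 2 first.
- by right; rewrite lx.
- by right; rewrite lx.
have [[rz lz]|[_ lz]|[_ lz]] := label_type zb; last 2 first.
- rewrite lx lz in e; discriminate e.
- rewrite lx lz in e; discriminate e.
have := drow_compatible G_conn lam diam dia xb zb xz.
by rewrite rx rz => /and5P[].
Qed.

(** Labels settle adjacency except between two vertices sharing a label, which is then 5 or 6.
    Whether these classes are cliques decides between Pt_2 and Pt_1. *)
Lemma label_adjE x z : x != z ->
  adj x z = if lab x == lab z then adj x z else ladj (lab x) (lab z).
Proof.
move=> xz; case: eqP => // /eqP lxz.
case: (boolP (x \in [:: p; r; o; t])) => [xb|xb]; first by have [] := base_adj xb xz.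
case: (boolP (z \in [:: p; r; o; t])) => [zb|zb].
  by rewrite eq_sym in xz; have [+ _] := base_adj zb xz; rewrite adj_sym ladj_sym.
by have [/negbTE -> /negbTE ->] := type_label_nonadj xb zb xz lxz.
Qed.

Lemma label_lt7 x : lab x < 7.
Proof.
case: (boolP (x \in [:: p; r; o; t])) => xb.
  by have := label_base xb; rewrite !inE => /or4P[] /eqP ->.
by case: (label_type xb) => -[_ ->].
Qed.

(** Without a vertex attached to [p] alone, [r] would be adjacent to all others and the diameter at
    most 2. *)
Lemma label_P : exists s, lab s = 5.
Proof.
case: (pickP [pred s | lab s == 5]) => [s /eqP ls|no]; first by exists s.
suff : diameter G <= 2 by rewrite diam.
apply: (@universal_diam G G_conn r) => x xr.
have rb : r \in [:: p; r; o; t] by rewrite !inE eqxx orbT.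
have [|-> _] := @base_adj r x rb; first by rewrite eq_sym.
have [_ lr _ _] := base_labels; rewrite lr.
have : lab x != 3.
  apply: contraNneq xr => lx; rewrite -lr in lx.
  have [->|] := same_label lx; first exact: eqxx.
  rewrite lx lr => h; discriminate h.
move/negbT: (no x) => /=; have := label_lt7 x.
by case: (lab x) => [|[|[|[|[|[|[|?]]]]]]].
Qed.

Lemma label_R : exists s, lab s = 6.
Proof.
case: (pickP [pred s | lab s == 6]) => [s /eqP ls|no]; first by exists s.
suff : diameter G <= 2 by rewrite diam.
apply: (@universal_diam G G_conn p) => x xp.
have pb : p \in [:: p; r; o; t] by rewrite !inE eqxx.
have [|-> _] := @base_adj p x pb; first by rewrite eq_sym.
have [lp _ _ _] := base_labels; rewrite lp.
have : lab x != 1.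
  apply: contraNneq xp => lx; rewrite -lp in lx.
  have [->|] := same_label lx; first exact: eqxx.
  rewrite lx lp => h; discriminate h.
move/negbT: (no x) => /=; have := label_lt7 x.
by case: (lab x) => [|[|[|[|[|[|[|?]]]]]]].
Qed.
End Oriented.
End Labels.

(** * Nonadjacent vertices attached to one hub, and the resulting labelling *)

Section Final.
Local Opaque dist.
Variables (R : rcfType) (G : sgraph).
Hypotheses (G_conn : connected G) (lam : (lambda R G 2 < - (1 / 2))%R).
Hypothesis diam : diameter G = 3.

Definition oriented (p r o t : G) :=
  diamond_in p r o t /\ forall w, w \notin [:: p; r; o; t] ->
    drow p r o t w \in [:: typeQ; typeP; typeR].

Lemma oriented_swap (p r o t : G) : oriented p r o t -> oriented r p o t.
Proof.
case=> dia ori; split; first exact: diamond_swap_pr.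
move=> w wb; have := ori w.
have -> : w \notin [:: p; r; o; t] by move: wb; rewrite !inE orbCA.
move/(_ isT); rewrite !drowE !inE => /or3P[] /eqP[-> -> -> ->] //.
Qed.

Section Split.
Variables p r o t x y : G.
Hypothesis ori : oriented p r o t.
Hypotheses (xR : drow p r o t x = typeR) (yR : drow p r o t y = typeR).
Hypotheses (xy : x != y) (nxy : ~~ adj x y).
Local Notation row := (drow p r o t).
Local Notation base := [:: p; r; o; t].
Let dia := ori.1.

Lemma drow_not_base w : row w \in [:: typeQ; typeP; typeR] -> w \notin base.
Proof.
apply: contraL; case: (base_rows G_conn dia) => rp rr ro rt.
by rewrite !inE => /or4P[] /eqP ->; rewrite ?rp ?rr ?ro ?rt.
Qed.

Let xb : x \notin base. Proof. by apply: drow_not_base; rewrite xR. Qed.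
Let yb : y \notin base. Proof. by apply: drow_not_base; rewrite yR. Qed.

Lemma dist_typeP_typeR s w : row s = typeP -> row w = typeR ->
  dist s w = 3 /\ dist w s = 3.
Proof.
move=> sP wR.
have sb : s \notin base by apply: drow_not_base; rewrite sP.
have wb : w \notin base by apply: drow_not_base; rewrite wR.
have sw : s != w by apply: contra_eq_neq sP => ->; rewrite wR.
have := drow_compatible G_conn lam diam dia sb wb sw.
by rewrite sP wR (dist_sym G_conn w) => /and5P[_ _ /eqP -> _ _].
Qed.

Lemma typeR_adj w : row w = typeR -> adj r w.
Proof. by rewrite drowE -dist1 // => -[_ -> _ _]. Qed.

Let dxy : dist x y = 2.
Proof.
by have [] := @common_dist G G_conn x y r xy nxy _ _; rewrite // adj_sym typeR_adj.
Qed.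

Let vs s := [:: p; r; o; t; x; y; s].

Lemma split_uniq s : row s = typeP -> uniq (vs s).
Proof.
move=> sP; have sb : s \notin base by apply: drow_not_base; rewrite sP.
have sx : s != x by apply: contra_eq_neq sP => ->; rewrite xR.
have sy : s != y by apply: contra_eq_neq sP => ->; rewrite yR.
have -> : vs s = rcons (rcons (rcons base x) y) s by [].
have yx : y \notin rcons base x by rewrite mem_rcons in_cons negb_or eq_sym xy yb.
have syx : s \notin rcons (rcons base x) y.
  by rewrite mem_rcons in_cons negb_or sy mem_rcons in_cons negb_or sx sb.
by rewrite !rcons_uniq syx yx xb (diamond_uniq dia).
Qed.

Lemma split_dmat s : row s = typeP -> dmat (vs s) = split_mx.
Proof.
move=> sP; have -> : vs s = rcons (rcons (rcons base x) y) s by [].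
rewrite !dmat_rcons // !map_rcons (diamond_dmat G_conn dia).
have [_ dx] := dist_typeP_typeR sP xR; have [_ dy] := dist_typeP_typeR sP yR.
by rewrite -!/(row _) xR yR sP dxy dx dy.
Qed.

Lemma split_feasible s w : row s = typeP -> w \notin vs s ->
  feasible (extend split_mx
    (rcons (rcons (rcons (row w) (dist x w)) (dist y w)) (dist s w))).
Proof.
move=> sP ws; rewrite -(split_dmat sP).
have -> : rcons (rcons (rcons (row w) (dist x w)) (dist y w)) (dist s w)
   = [seq dist v w | v <- vs s] by [].
by rewrite -dmat_rcons //; apply: (dmat_feasible G_conn lam);
    rewrite rcons_uniq ws split_uniq.
Qed.

Lemma notin_vs s w : w \notin base -> w != x -> w != y -> w != s -> w \notin vs s.
Proof. by rewrite !inE !negb_or => /and4P[-> -> -> ->] -> -> ->. Qed.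

Lemma split_P_uniq s s' : row s = typeP -> row s' = typeP -> s = s'.
Proof.
move=> sP sP'; apply/eqP/negPn/negP => ss.
have sb : s' \notin base by apply: drow_not_base; rewrite sP'.
have sx : s' != x by apply: contra_eq_neq sP' => ->; rewrite xR.
have sy : s' != y by apply: contra_eq_neq sP' => ->; rewrite yR.
have ws : s' \notin vs s by rewrite notin_vs // eq_sym.
have := split_feasible sP ws.
have [_ dx] := dist_typeP_typeR sP' xR; have [_ dy] := dist_typeP_typeR sP' yR.
rewrite sP' dx dy; apply/negP.
exact: (allP split_typeP _ (dist_in G_conn diam ss)).
Qed.

Lemma split_R_xor s z : row s = typeP -> row z = typeR -> z != x -> z != y ->
  adj x z (+) adj y z.
Proof.
move=> sP zR zx zy; have zb : z \notin base by apply: drow_not_base; rewrite zR.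
have zs : z != s by apply: contra_eq_neq zR => ->; rewrite sP.
have := split_feasible sP (notin_vs zb zx zy zs).
have [dz _] := dist_typeP_typeR sP zR; rewrite zR dz => F.
rewrite eq_sym in zx; rewrite eq_sym in zy.
have /allP/(_ _ (dist_in G_conn diam zy)) := allP split_R _ (dist_in G_conn diam zx).
by move/implyP/(_ F); rewrite !dist1.
Qed.

Lemma split_R_uniq s z z' : row s = typeP -> row z = typeR -> row z' = typeR ->
  z != x -> z != y -> z' != x -> z' != y -> z = z'.
Proof.
move=> sP zR zR' zx zy zx' zy'; apply/eqP/negPn/negP => zz.
have zb : z \notin base by apply: drow_not_base; rewrite zR.
have zs : z != s by apply: contra_eq_neq zR => ->; rewrite sP.
have zb' : z' \notin base by apply: drow_not_base; rewrite zR'.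
have zs' : z' != s by apply: contra_eq_neq zR' => ->; rewrite sP.
have [dz _] := dist_typeP_typeR sP zR; have [dz' _] := dist_typeP_typeR sP zR'.
have nz := notin_vs zb zx zy zs; have nz' := notin_vs zb' zx' zy' zs'.
have F := split_feasible sP nz; rewrite zR dz in F.
have mz : dmat (rcons (vs s) z) = extend split_mx (typeR ++ [:: dist x z; dist y z; 3]).
  rewrite dmat_rcons // split_dmat //.
  have -> : [seq dist v z | v <- vs s] =
    rcons (rcons (rcons (row z) (dist x z)) (dist y z)) (dist s z) by [].
  by rewrite zR dz.
have : feasible (dmat (rcons (rcons (vs s) z) z')).
  apply: (dmat_feasible G_conn lam); rewrite !rcons_uniq mem_rcons inE negb_or.
  by rewrite nz nz' split_uniq // eq_sym zz.
rewrite dmat_rcons // mz map_rcons.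
have -> : [seq dist v z' | v <- vs s] =
    rcons (rcons (rcons (row z') (dist x z')) (dist y z')) (dist s z') by [].
rewrite zR' dz'.
rewrite eq_sym in zx; rewrite eq_sym in zy; rewrite eq_sym in zx';
    rewrite eq_sym in zy'.
have /allP/(_ _ (dist_in G_conn diam zy)) := allP split_RR _ (dist_in G_conn diam zx).
rewrite /split_R2 F => /allP/(_ _ (dist_in G_conn diam zx')).
move/allP/(_ _ (dist_in G_conn diam zy'))/allP/(_ _ (dist_in G_conn diam zz)).
by move/negP.
Qed.
End Split.

(** A third vertex of type R is adjacent to exactly one of x and y. That one is called y', so that
    x', y' and the third vertex can take the places of x, y, z in Pt_1. *)
Lemma split_normal (p r o t x y : G) : oriented p r o t ->
  drow p r o t x = typeR -> drow p r o t y = typeR -> x != y -> ~~ adj x y ->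
  exists x' y' : G, [/\ drow p r o t x' = typeR, drow p r o t y' = typeR, x' != y',
    ~~ adj x' y' & forall z, drow p r o t z = typeR -> z != x' -> z != y' ->
      ~~ adj x' z /\ adj y' z].
Proof.
move=> ori xR yR xy nxy; have [dia typ] := ori.
have [s ls] := label_P G_conn lam diam dia typ.
have sP : drow p r o t s = typeP.
  have : type_label p r o t s < size type_rows by rewrite ls.
  by rewrite index_mem => /(nth_index [::]); rewrite -/(type_label p r o t s) ls.
case: (pickP [pred z | [&& drow p r o t z == typeR, z != x,
    z != y & adj x z]]) => [z|no].
  case/and4P=> /eqP zR zx zy xz; exists y, x; split => //.
  - by rewrite eq_sym.
  - by rewrite adj_sym.
  - move=> z' zR' zy' zx'; rewrite (split_R_uniq ori xR yR xy nxy sP zR' zR zx'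
      zy' zx zy).
    by have := split_R_xor ori xR yR xy nxy sP zR zx zy; rewrite xz.
exists x, y; split => // z zR zx zy; have := no z; rewrite /= zR zx zy eqxx /= => nxz.
by have := split_R_xor ori xR yR xy nxy sP zR zx zy; rewrite nxz.
Qed.

Lemma split_labelling (p r o t x y : G) : oriented p r o t ->
  drow p r o t x = typeR -> drow p r o t y = typeR -> x != y -> ~~ adj x y ->
  exists2 c : G -> 'I_9, label_adjacency c & injective c.
Proof.
move=> ori xR0 yR0 xy0 nxy0.
have [{xR0 yR0 xy0 nxy0}x [{}y [xR yR xy nxy norm]]] := split_normal ori xR0
    yR0 xy0 nxy0.
have [dia typ] := ori.
pose lab := type_label p r o t.
have lab6 w : (lab w == 6) = (drow p r o t w == typeR).
  apply/eqP/eqP => [lw|]; last by rewrite /lab /type_label => ->.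
  have : lab w < size type_rows by rewrite lw.
  by rewrite index_mem => /(nth_index [::]);
      rewrite -/(type_label p r o t w) -/(lab w) lw.
have lab5 w : lab w = 5 -> drow p r o t w = typeP.
  move=> lw; have : lab w < size type_rows by rewrite lw.
  by rewrite index_mem => /(nth_index [::]);
      rewrite -/(type_label p r o t w) -/(lab w) lw.
have lt7 w : lab w < 7 by apply: (label_lt7 G_conn).
have [s ls] := label_P G_conn lam diam dia typ.
have sP := lab5 _ ls.
(* All vertices of type R have label 6 under [lab]; they are spread over 6, 7 and 8. *)
pose n w := if w == x then 6 else if w == y then 7 else if lab w == 6 then 8 else lab w.
have n9 w : n w < 9.
  by rewrite /n; do 3?case: ifP => // _; apply: leq_trans (lt7 w) _.
have nE w : [\/ n w = lab w /\ lab w < 6, [/\ w = x, lab w = 6 & n w = 6],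
    [/\ w = y, lab w = 6 & n w = 7] |
    [/\ w != x, w != y, drow p r o t w = typeR & lab w = 6 /\ n w = 8]].
  have lx : lab x = 6 by apply/eqP; rewrite lab6 xR.
  have ly : lab y = 6 by apply/eqP; rewrite lab6 yR.
  rewrite /n; have [->|wx] := eqVneq w x; first by apply: Or42.
  have [->|wy] := eqVneq w y; first by apply: Or43.
  case: eqP => [lw|/eqP lw].
    by apply: Or44; split=> //; apply/eqP; rewrite -lab6 lw.
  by apply: Or41; rewrite ltn_neqAle lw -ltnS lt7.
have labE w z : w != z ->
    adj w z = if lab w == lab z then adj w z else ladj (lab w) (lab z).
  exact: (label_adjE G_conn lam diam dia typ).
have lab_same w z : lab w = lab z -> w = z \/ 4 < lab w.
  exact: (same_label G_conn lam diam dia typ).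
clearbody lab n.
have ninj w z : n w = n z -> w = z.
  have [[nw lw]|[ew _ nw]|[ew _ nw]|[wx wy wR [_ nw]]] := nE w;
    have [[nz lz]|[ez _ nz]|[ez _ nz]|[zx zy zR [_ nz]]] := nE z;
    rewrite nw nz => e; try discriminate e.
  - have [//|] := lab_same _ _ e.
    rewrite leq_eqVlt ltnNge -ltnS lw orbF => /eqP/esym lw5.
    apply: (split_P_uniq ori xR yR xy nxy); apply: lab5; first exact: lw5.
    by rewrite -e.
  - rewrite e in lw; discriminate lw.
  - rewrite e in lw; discriminate lw.
  - rewrite e in lw; discriminate lw.
  - rewrite -e in lz; discriminate lz.
  - by rewrite ew ez.
  - rewrite -e in lz; discriminate lz.
  - by rewrite ew ez.
  - rewrite -e in lz; discriminate lz.
  - exact: (split_R_uniq ori xR yR xy nxy sP wR zR).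
exists (fun w => Ordinal (n9 w)); last by move=> w z /(congr1 val) /ninj.
move=> w z wz; rewrite -val_eqE /=; have nwz : n w != n z.
  by apply: contraNneq wz => /ninj ->.
(* Among the labels below 6, the neighbours of 7 and 8 are those of 6, so adjacencies known for
   [lab] carry over to [n]. *)
have ladj6 k : k < 6 -> (ladj k 7 = ladj k 6) * (ladj k 8 = ladj k 6) *
     (ladj 7 k = ladj 6 k) * (ladj 8 k = ladj 6 k).
  by case: k => [|[|[|[|[|[|?]]]]]].
rewrite (negbTE nwz) /=.
have ne6 k : k < 6 -> ((k == 6) = false) * ((6 == k) = false).
  by move=> k6; rewrite eq_sym gtn_eqF.
have := labE _ _ wz; move: nwz; case: (nE w) =>
    [[nw lw]|[ew lw nw]|[ew lw nw]|[wx wy wR [lw nw]]];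
  case: (nE z) => [[nz lz]|[ez lz nz]|[ez lz nz]|[zx zy zR [lz nz]]];
  rewrite nw nz ?lw ?lz ?ew ?ez ?(ladj6 _ lw) ?(ladj6 _ lz) ?(ne6 _ lw) ?(ne6 _ lz) //=.
- by move=> /negbTE ->.
- by rewrite (negbTE nxy).
- by have [/negbTE -> _] := norm z zR zx zy.
- by rewrite adj_sym (negbTE nxy).
- by have [_ ->] := norm z zR zx zy.
- by rewrite adj_sym; have [/negbTE -> _] := norm w wR wx wy.
- by rewrite adj_sym; have [_ ->] := norm w wR wx wy.
Qed.

(** If vertices sharing a label are always adjacent, the labels below 7 serve, and all of them
    except possibly 2 occur, as a Pt_2 requires. Otherwise two nonadjacent vertices share the label
    6, or the label 5, which an exchange of the hubs turns into type R. *)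
Lemma necessary_labelling : ~~ block_graph G ->
  exists2 c : G -> 'I_9, label_adjacency c &
    [/\ forall x y, c x = c y -> x = y \/ 4 < c x, forall x, c x < 7 &
        forall k, k \in [:: 0; 1; 3; 4; 5; 6] -> exists x, c x = k :> nat]
    \/ injective c.
Proof.
move=> nb; have [p [r [o0 [t0 dia0]]]] := diamond_exists G_conn lam diam nb.
have [o [t ori]] := oriented_diamond G_conn lam diam dia0.
have {}ori : oriented p r o t by [].
have split_case p' r' x y : oriented p' r' o t -> drow p' r' o t x = typeR ->
    drow p' r' o t y = typeR -> x != y -> ~~ adj x y ->
    exists2 c : G -> 'I_9, label_adjacency c & injective c.
  exact: split_labelling.
have [dia typ] := ori; pose lab := type_label p r o t.
have lt7 w : lab w < 7 by apply: (label_lt7 G_conn).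
have lt9 w : lab w < 9 by apply: leq_trans (lt7 w) _.
have rowE w : drow p r o t w = nth [::] type_rows (lab w).
  by rewrite nth_index // -index_mem; apply: lt7.
case: (boolP [forall x, forall y, (x != y) && (lab x == lab y) ==> adj x y]) => [cl|].
  exists (fun w => Ordinal (lt9 w)).
    move=> x y xy; rewrite -val_eqE /=.
    have -> := label_adjE G_conn lam diam dia typ xy; rewrite -!/(lab _).
    case: ifP => // lxy; rewrite orTb.
    by have /forallP/(_ x)/forallP/(_ y) := cl; rewrite xy lxy.
  left; split=> [x y /(congr1 val) /= e|x|k].
  - exact: (same_label G_conn lam diam dia typ).
  - exact: lt7.
  - have [lp lr lo lt] := base_labels G_conn dia.
    rewrite !inE; do 5?[case/orP]; move/eqP=> ->.
    + by exists o.
    + by exists p.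
    + by exists r.
    + by exists t.
    + by have [s ls] := label_P G_conn lam diam dia typ; exists s.
    + by have [s ls] := label_R G_conn lam diam dia typ; exists s.
rewrite negb_forall => /existsP[x]; rewrite negb_forall => /existsP[y].
rewrite negb_imply => /andP[/andP[xy /eqP lxy] nxy].
suff [c c1 c2] : exists2 c : G -> 'I_9, label_adjacency c & injective c.
  by exists c; last right.
have [/eqP|] := same_label G_conn lam diam dia typ lxy; first by rewrite (negbTE xy).
rewrite leq_eqVlt => /orP[/eqP l5|l6]; last first.
  have l6' : lab x = 6 by apply/eqP; rewrite eqn_leq -ltnS lt7.
  have xR : drow p r o t x = typeR by rewrite rowE l6'.
  have yR : drow p r o t y = typeR by rewrite rowE -lxy l6'.
  exact: (split_case p r x y ori xR yR xy nxy).
have swapR w : lab w = 5 -> drow r p o t w = typeR.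
  by move=> lw; have := rowE w; rewrite lw !drowE => -[-> -> -> ->].
have xR : drow r p o t x = typeR by apply: swapR; exact: esym l5.
have yR : drow r p o t y = typeR by apply: swapR; rewrite -lxy; exact: esym l5.
exact: (split_case r p x y (oriented_swap ori) xR yR xy nxy).
Qed.
End Final.

(** * Blocks of labelled graphs *)

Lemma inj_surj_bij (T : finType) (U : eqType) (f : T -> U) :
  injective f -> (forall y, exists x, f x = y) -> bijective f.
Proof.
move=> f_inj f_surj.
have ex y : exists x, f x == y by have [x <-] := f_surj y; exists x.
exists (fun y => xchoose (ex y)) => [x|y]; last exact/eqP/(xchooseP (ex y)).
by apply: f_inj; apply/eqP/(xchooseP (ex (f x))).
Qed.

Lemma isomorphic_connected (G K : sgraph) :
  isomorphic G K -> connected G -> connected K.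
Proof.
case=> f [g fK gK] f_mono /connectedP Gc; apply/connectedP => x y.
have /connectP[q qp yq] := Gc (g x) (g y).
rewrite -[x]gK -[y]gK yq; elim: q (g x) qp {yq} => [|b q IH] a /= ;
    first by rewrite connect0.
case/andP=> ab /IH; apply: connect_trans; apply: connect1.
by rewrite f_mono.
Qed.

Lemma isomorphic_induced_setT (G : sgraph) : isomorphic G (induced [set: G]).
Proof.
exists (fun x => Sub x (in_setT x)) => //.
exists val => [x|x]; first exact: SubK.
by apply: val_inj; rewrite SubK.
Qed.

Section ConnectedSets.
Variable G : sgraph.
Implicit Types A B S : {set G}.

Lemma connect_in_sym A x y : connect_in A x y = connect_in A y x.
Proof. by apply: sym_connect_sym => a b /=; rewrite andbCA adj_sym. Qed.

Lemma connect_in_trans A x y z :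
  connect_in A x y -> connect_in A y z -> connect_in A x z.
Proof. exact: connect_trans. Qed.

Lemma connect_in_sub A B x y : A \subset B -> connect_in A x y -> connect_in B x y.
Proof.
move=> /subsetP AB; apply: connect_sub => a b /= /and3P[aA bA ab].
by apply: connect1; rewrite /= !AB.
Qed.

Lemma connect_in_adj A x y : x \in A -> y \in A -> adj x y -> connect_in A x y.
Proof. by move=> xA yA xy; apply: connect1; rewrite /= xA yA. Qed.

Lemma connected_setP A :
  reflect {in A &, forall x y, connect_in A x y} (connected_set A).
Proof.
apply: (iffP forall_inP) => [h x y xA|h x xA].
  exact: (forall_inP (h x xA)).
by apply/forall_inP => y; apply: h.
Qed.

Lemma connect_in_closed A S x y : connect_in A x y -> x \in S ->
  (forall a b, a \in S -> b \in A -> adj a b -> b \in S) -> y \in S.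
Proof.
case/connectP=> q + -> xS clS; elim: q x xS => //= b q IH x xS.
by case/andP=> /and3P[_ bA xb] /IH; apply; apply: clS xb.
Qed.

Lemma star_connected A u : u \in A -> {in A, forall x, x != u -> adj u x} ->
  connected_set A.
Proof.
move=> uA star; have ux x : x \in A -> connect_in A u x.
  move=> xA; have [->|xu] := eqVneq x u; first exact: connect0.
  by apply: connect_in_adj => //; apply: star.
apply/connected_setP => x y xA yA.
by apply: connect_in_trans (ux y yA); rewrite connect_in_sym ux.
Qed.

Lemma cliqueP A : reflect {in A &, forall x y, x != y -> adj x y} (clique A).
Proof.
apply: (iffP forall_inP) => [h x y xA yA xy|h x xA].
  by have /forall_inP/(_ y yA)/implyP := h x xA; apply.
by apply/forall_inP => y yA; apply/implyP; apply: h.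
Qed.

Lemma clique_connected A : clique A -> connected_set A.
Proof.
move=> /cliqueP clA; have [->|[u uA]] := set_0Vmem A.
  by apply/connected_setP => x y; rewrite inE.
by apply: (star_connected uA) => x xA xu; apply: clA; rewrite // eq_sym.
Qed.

Lemma nonseparableP A :
  reflect [/\ A != set0, connected_set A & forall x, connected_set (A :\ x)]
    (nonseparable A).
Proof.
apply: (iffP and3P) => -[A0 Ac cut]; split=> //.
  move=> x; have := forallP cut x; rewrite /cut_vertex;
      case: (boolP (x \in A)) => /= xA.
    by rewrite negbK.
  by move=> _; have /setDidPl -> : [disjoint A & [set x]] by rewrite
      disjoint_sym disjoints1.
by apply/forallP => x; rewrite negb_and negbK cut orbT.
Qed.

Lemma clique_nonseparable A : A != set0 -> clique A -> nonseparable A.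
Proof.
move=> A0 /cliqueP clA; apply/nonseparableP; split=> //.
  exact/clique_connected/cliqueP.
move=> x; apply/clique_connected/cliqueP => a b;
    rewrite !inE => /andP[_ aA] /andP[_ bA].
exact: clA.
Qed.

Lemma connected_via A y : y \in A -> {in A, forall x, connect_in A y x} ->
  connected_set A.
Proof.
move=> yA h; apply/connected_setP => a b aA bA.
by apply: connect_in_trans (h b bA); rewrite connect_in_sym h.
Qed.

Lemma connected_setU1 A w y : connected_set A -> y \in A -> adj w y ->
  connected_set (w |: A).
Proof.
move=> /connected_setP Ac yA wy; have yA' : y \in w |: A by rewrite !inE yA orbT.
apply: (connected_via yA') => x; rewrite !inE => /orP[/eqP ->|xA].
  by apply: connect_in_adj; rewrite ?setU11 // adj_sym.
by apply: (@connect_in_sub A); [apply: subsetUr | apply: Ac].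
Qed.

(** Whichever vertex is deleted, w keeps u or v as a neighbour. By maximality, a vertex outside a
    block has at most one neighbour in it. *)
Lemma nonseparableU1 A w u v : nonseparable A -> u \in A -> v \in A -> u != v ->
  adj w u -> adj w v -> nonseparable (w |: A).
Proof.
move=> /nonseparableP[A0 Ac cut] uA vA uv wu wv.
have [wA|wA] := boolP (w \in A).
  have -> : w |: A = A by apply/setUidPr; rewrite sub1set.
  exact/nonseparableP.
apply/nonseparableP; split.
- by apply/set0Pn; exists w; rewrite setU11.
- exact: connected_setU1 uA wu.
- move=> x; have [->|xw] := eqVneq x w; first by rewrite setU1K.
  have -> : (w |: A) :\ x = w |: (A :\ x).
    by apply/setP => z; rewrite !inE; case: (z =P w) => // ->; rewrite eq_sym xw.
  have [xu|xu] := eqVneq x u.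
    by apply: (@connected_setU1 _ _ v) => //; rewrite !inE vA andbT eq_sym xu.
  by apply: (@connected_setU1 _ _ u) => //; rewrite !inE uA andbT eq_sym xu.
Qed.

(** One leaves S only through c, so deleting c would cut x off from any vertex of A lying
    elsewhere. *)
Lemma nonseparable_side A S c x : nonseparable A ->
  (forall a b, a \in S -> b \notin S -> adj a b -> b = c) ->
  x \in A -> x \in S -> A \subset c |: S.
Proof.
move=> /nonseparableP[_ Ac cut] out xA xS; apply/subsetP => y yA.
rewrite !inE; case: (y =P c) => //= /eqP yc.
have [cx|xc] := eqVneq c x.
  have /connected_setP/(_ x y xA yA)/connect_in_closed := Ac; apply=> // a b aS _ ab.
  by apply/negPn/negP => bS; move: (bS); rewrite (out a b aS bS ab) cx xS.
have /connected_setP/(_ x y) := cut c.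
rewrite !inE xA yA yc eq_sym xc => /(_ isT isT) /connect_in_closed; apply=> // a b aS.
rewrite !inE => /andP[bc _] ab; apply/negPn/negP => bS.
by rewrite (out a b aS bS ab) eqxx in bc.
Qed.

Lemma nonseparable_in_block A : nonseparable A ->
  exists2 B, B \in blocks G & A \subset B.
Proof.
by move=> /maxset_exists[B maxB AB]; exists B; rewrite ?inE.
Qed.

Lemma block_cover x : exists2 B, B \in blocks G & x \in B.
Proof.
have /nonseparable_in_block[B Bb xB] : nonseparable [set x].
  apply: clique_nonseparable; first by apply/set0Pn; exists x; rewrite inE.
  by apply/cliqueP => a b /set1P -> /set1P ->; rewrite eqxx.
by exists B; rewrite // -sub1set.
Qed.

Lemma edge_in_block x y : adj x y -> exists2 B, B \in blocks G & (x \in B) && (y \in B).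
Proof.
move=> xy; have /nonseparable_in_block[B Bb xyB] : nonseparable [set x; y].
  apply: clique_nonseparable; first by apply/set0Pn; exists x; rewrite set21.
  apply/cliqueP => a b; rewrite !inE => /orP[] /eqP -> /orP[] /eqP -> //;
      rewrite ?eqxx //.
  by rewrite adj_sym.
by exists B => //; move: xyB; rewrite subUset !sub1set.
Qed.

Lemma blocks_eq (B P Q : {set G}) :
  nonseparable B -> nonseparable P -> nonseparable Q ->
  ~~ (B \subset P) -> ~~ (B \subset Q) -> ~~ (P \subset B) -> ~~ (P \subset Q) ->
  ~~ (Q \subset B) -> ~~ (Q \subset P) ->
  (forall A, nonseparable A -> [\/ A \subset B, A \subset P | A \subset Q]) ->
  blocks G = [set B; P; Q] /\ #|blocks G| = 3.
Proof.
move=> Bn Pn Qn BP BQ PB PQ QB QP cov.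
have BnP : B != P by apply: contraNneq BP => ->.
have BnQ : B != Q by apply: contraNneq BQ => ->.
have PnQ : P != Q by apply: contraNneq PQ => ->.
have e : blocks G = [set B; P; Q].
  apply/setP => A; rewrite !inE; apply/idP/idP => [/maxsetP[An Amax]|].
    by have [/Amax|/Amax|/Amax] := cov A An; move/(_ _) => <-; rewrite ?eqxx ?orbT.
  case/orP=> [/orP[]|] /eqP ->; apply/maxsetP; split=> // C Cn sub;
    have [CB|CP|CQ] := cov C Cn; apply/eqP; rewrite eqEsubset sub andbT //.
  - by rewrite (subset_trans sub CP) in BP.
  - by rewrite (subset_trans sub CQ) in BQ.
  - by rewrite (subset_trans sub CB) in PB.
  - by rewrite (subset_trans sub CQ) in PQ.
  - by rewrite (subset_trans sub CB) in QB.
  - by rewrite (subset_trans sub CP) in QP.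
split=> //; rewrite e -setUA cardsU1 cards2 !inE negb_or BnP BnQ.
by rewrite PnQ.
Qed.
End ConnectedSets.

(** * From a labelling with labels below 7 to a triple block graph *)

Section Triple.
Variables (G : sgraph) (c : G -> 'I_9).
Hypotheses (G_conn : connected G) (c_adj : label_adjacency c).
Hypothesis c_same : forall x y, c x = c y -> x = y \/ 4 < c x.
Hypothesis c_lt7 : forall x, c x < 7.

Lemma label_neq x y : c x != c y -> x != y.
Proof. by apply: contraNneq => ->. Qed.

Lemma label_eq x k : c x = k :> nat -> k < 5 -> forall y, c y = k :> nat -> y = x.
Proof.
move=> cx k5 y cy; have e : c y = c x by apply: ord_inj; rewrite cx cy.
by have [//|] := c_same e; rewrite cy ltnNge -ltnS k5.
Qed.

Lemma label_adj_val x y : x != y -> adj x y = (c x == c y :> nat) || ladj (c x) (c y).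
Proof. exact: c_adj. Qed.

Definition center_block : {set G} := [set x | c x < 5].
Definition left_block : {set G} := [set x | (c x == 1 :> nat) || (c x == 5 :> nat)].
Definition right_block : {set G} := [set x | (c x == 3 :> nat) || (c x == 6 :> nat)].

Lemma left_clique : clique left_block.
Proof.
apply/cliqueP => x y; rewrite !inE => xl yl xy; rewrite label_adj_val //.
by case/orP: xl => /eqP ->; case/orP: yl => /eqP ->.
Qed.

Lemma right_clique : clique right_block.
Proof.
apply/cliqueP => x y; rewrite !inE => xl yl xy; rewrite label_adj_val //.
by case/orP: xl => /eqP ->; case/orP: yl => /eqP ->.
Qed.

Variables p r o t s x : G.
Hypotheses (cp : c p = 1 :> nat) (cr : c r = 3 :> nat) (co : c o = 0 :> nat)
  (ct : c t = 4 :> nat) (cs : c s = 5 :> nat) (cx : c x = 6 :> nat).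

(** Each hub is adjacent to all other vertices with labels below 5. After the deletion of any vertex
    one hub remains, and with it a star; hence the center has no cut vertex. *)
Lemma center_star u (A : {set G}) : (c u == 1 :> nat) || (c u == 3 :> nat) -> u \in A ->
  A \subset center_block -> connected_set A.
Proof.
move=> cu uA /subsetP AB; apply: (star_connected uA) => y yA yu.
have := AB y yA; rewrite inE label_adj_val 1?eq_sym // => y5.
have : c y != c u :> nat.
  apply: contraNneq yu => e; have [->//|] := c_same (ord_inj e).
  by rewrite ltnNge -ltnS y5.
move: y5; case/orP: cu => /eqP ->; by case: (c y) => [] [|[|[|[|[|?]]]]].
Qed.

Lemma center_nonseparable : nonseparable center_block.
Proof.
have pB : p \in center_block by rewrite inE cp.
have rB : r \in center_block by rewrite inE cr.
apply/nonseparableP; split; first by apply/set0Pn; exists p.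
  by apply: (@center_star p); rewrite ?cp.
move=> y; have [->|yp] := eqVneq y p.
  apply: (@center_star r); rewrite ?cr ?subD1set // !inE cr andbT.
  by apply: label_neq; rewrite -val_eqE /= cr cp.
by apply: (@center_star p); rewrite ?cp ?subD1set // !inE cp andbT eq_sym.
Qed.

(** Vertices with label 5 have only p as neighbour outside their class, and those with label 6 only
    r; [nonseparable_side] applies to these classes. *)
Lemma triple_cover (A : {set G}) : nonseparable A ->
  [\/ A \subset center_block, A \subset left_block | A \subset right_block].
Proof.
move=> An.
have [[a /andP[aA a5]]|noP] := altP (@existsP _ (fun a : G =>
    (a \in A) && (c a == 5 :> nat))).
  apply: Or32; have := @nonseparable_side G A [set y | c y == 5 :> nat] p a An.
  move=> H; apply: subset_trans (H _ aA _) _; rewrite ?inE //.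
    move=> u v; rewrite !inE => /eqP cu cv uv.
    have := c_adj (adj_neq uv); rewrite uv cu => /esym.
    rewrite -val_eqE /= cu eq_sym (negbTE cv) /=.
    move=> h; apply: (label_eq cp) => //.
    by move: h (c_lt7 v); case: (c v) => [] [|[|[|[|[|[|[|?]]]]]]].
  by apply/subsetP => y; rewrite !inE => /orP[/eqP ->|->]; rewrite ?cp ?orbT.
have [[a /andP[aA a6]]|noR] := altP (@existsP _ (fun a : G =>
    (a \in A) && (c a == 6 :> nat))).
  apply: Or33; have := @nonseparable_side G A [set y | c y == 6 :> nat] r a An.
  move=> H; apply: subset_trans (H _ aA _) _; rewrite ?inE //.
    move=> u v; rewrite !inE => /eqP cu cv uv.
    have := c_adj (adj_neq uv); rewrite uv cu => /esym.
    rewrite -val_eqE /= cu eq_sym (negbTE cv) /=.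
    move=> h; apply: (label_eq cr) => //.
    by move: h (c_lt7 v); case: (c v) => [] [|[|[|[|[|[|[|?]]]]]]].
  by apply/subsetP => y; rewrite !inE => /orP[/eqP ->|->]; rewrite ?cr ?orbT.
apply: Or31; apply/subsetP => y yA; rewrite inE.
move: noP noR; rewrite !negb_exists => /forallP/(_ y) n5 /forallP/(_ y).
by move: n5 (c_lt7 y); rewrite !yA /=; case: (c y) => [] [|[|[|[|[|[|[|?]]]]]]].
Qed.

Lemma triple_blocks : blocks G = [set center_block; left_block; right_block] /\
  #|blocks G| = 3.
Proof.
have nsub y (A B : {set G}) : y \in A -> y \notin B -> ~~ (A \subset B).
  by move=> yA; apply: contra => /subsetP; apply.
apply: blocks_eq.
- exact: center_nonseparable.
- by apply: clique_nonseparable left_clique; apply/set0Pn; exists p; rewrite inE cp.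
- by apply: clique_nonseparable right_clique; apply/set0Pn; exists r; rewrite inE cr.
- by apply: (nsub o); rewrite inE co.
- by apply: (nsub o); rewrite inE co.
- by apply: (nsub s); rewrite inE cs.
- by apply: (nsub s); rewrite inE cs.
- by apply: (nsub x); rewrite inE cx.
- by apply: (nsub x); rewrite inE cx.
- exact: triple_cover.
Qed.

Lemma center_iso :
  isomorphic (induced center_block) full_house \/
  isomorphic (induced center_block) diamond.
Proof.
(* [f] and [g] translate labels into the numberings of [full_house] and [diamond], hubs going to 0
   and 1. The entry of [g] at 2 is a filler: that label does not occur in its case. *)
pose f k := nth 0 [:: 2; 0; 3; 1; 4] k.
pose g k := nth 0 [:: 2; 0; 2; 1; 3] k.
have lt5 (y : induced center_block) : c (val y) < 5 by have := valP y; rewrite inE.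
have f5 (y : induced center_block) : f (c (val y)) < 5.
  by have := lt5 y; case: (c (val y)) => [] [|[|[|[|[|?]]]]].
have c_inj (y z : induced center_block) : c (val y) = c (val z) :> nat -> y = z.
  by move=> /esym e; apply/val_inj/(label_eq e (lt5 _)).
have same (y z : induced center_block) : (y == z) = (c (val y) == c (val z) :> nat).
  by apply/eqP/eqP => [->|/c_inj].
have inB k (w : G) : c w = k :> nat -> k < 5 ->
    exists y : induced center_block, c (val y) = k :> nat.
  by move=> cw k5; have wB : w \in center_block by [rewrite inE cw];
      exists (Sub w wB); rewrite SubK.
have adjB (y z : induced center_block) : adj y z = (y != z) &&
    ladj (c (val y)) (c (val z)).
  have [<-|yz] := eqVneq y z; first by rewrite adj_irr.
  have -> : adj y z = adj (val y) (val z) by [].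
  rewrite label_adj_val; last by rewrite val_eqE.
  by move: yz; rewrite same => /negbTE ->.
case: (pickP [pred q | c q == 2 :> nat]) => [q /eqP cq|noq].
  left; exists (fun y => Ordinal (f5 y)).
    apply: inj_surj_bij => [y z /(congr1 val) /=|].
      move=> e; apply: c_inj; move: e (lt5 y) (lt5 z).
      by case: (c (val y)) => [] [|[|[|[|[|?]]]]] ?;
          case: (c (val z)) => [] [|[|[|[|[|?]]]]] ?.
    move=> [k k5].
    have [y cy] : exists y : induced center_block, f (c (val y)) = k.
      case: k k5 => [|[|[|[|[|?]]]]] // _.
      - by have [y cy] := inB _ p cp isT; exists y; rewrite cy.
      - by have [y cy] := inB _ r cr isT; exists y; rewrite cy.
      - by have [y cy] := inB _ o co isT; exists y; rewrite cy.
      - by have [y cy] := inB _ q cq isT; exists y; rewrite cy.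
      - by have [y cy] := inB _ t ct isT; exists y; rewrite cy.
    by exists y; apply: val_inj.
  move=> y z; rewrite adjB same.
  rewrite /= /edge_adj -val_eqE /=.
  move: (lt5 y) (lt5 z).
  by case: (c (val y)) => [] [|[|[|[|[|?]]]]] ?;
      case: (c (val z)) => [] [|[|[|[|[|?]]]]] ?.
have ne2 (y : induced center_block) : c (val y) != 2 :> nat.
  by have := noq (val y) => /= ->.
have g4 (y : induced center_block) : g (c (val y)) < 4.
  by have := lt5 y; case: (c (val y)) => [] [|[|[|[|[|?]]]]].
right; exists (fun y => Ordinal (g4 y)).
  apply: inj_surj_bij => [y z /(congr1 val) /=|].
    move=> e; apply: c_inj; move: e (lt5 y) (lt5 z) (ne2 y) (ne2 z).
    by case: (c (val y)) => [] [|[|[|[|[|?]]]]] ?;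
        case: (c (val z)) => [] [|[|[|[|[|?]]]]] ?.
  move=> [k k4].
  have [y cy] : exists y : induced center_block, g (c (val y)) = k.
    case: k k4 => [|[|[|[|?]]]] // _.
    - by have [y cy] := inB _ p cp isT; exists y; rewrite cy.
    - by have [y cy] := inB _ r cr isT; exists y; rewrite cy.
    - by have [y cy] := inB _ o co isT; exists y; rewrite cy.
    - by have [y cy] := inB _ t ct isT; exists y; rewrite cy.
  by exists y; apply: val_inj.
move=> y z; rewrite adjB same /= /edge_adj -val_eqE /=.
move: (lt5 y) (lt5 z) (ne2 y) (ne2 z).
by case: (c (val y)) => [] [|[|[|[|[|?]]]]] ?;
    case: (c (val z)) => [] [|[|[|[|[|?]]]]] ?.
Qed.

Lemma labelling_triple : triple_block_graph #|left_block| #|right_block| G /\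
  2 <= #|left_block| /\ 2 <= #|right_block|.
Proof.
have ps : p != s by apply: label_neq; rewrite -val_eqE /= cp cs.
have rx : r != x by apply: label_neq; rewrite -val_eqE /= cr cx.
have l2 : 2 <= #|left_block|.
  by apply/card_gt1P; exists p, s; split; rewrite ?inE ?cp ?cs.
have r2 : 2 <= #|right_block|.
  by apply/card_gt1P; exists r, x; split; rewrite ?inE ?cr ?cx.
split=> //; split=> //; exists center_block, left_block, right_block; split.
- exact: triple_blocks.
- exact: center_iso.
- by split=> //; apply: left_clique.
- by split=> //; apply: right_clique.
have pB : p \in center_block by rewrite inE cp.
have rB : r \in center_block by rewrite inE cr.
have oB : o \in center_block by rewrite inE co.
have tB : t \in center_block by rewrite inE ct.
pose u : induced center_block := Sub p pB; pose v : induced center_block := Sub r rB.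
pose a : induced center_block := Sub o oB; pose b : induced center_block := Sub t tB.
have sub_neq (y z : G) yB zB : c y != c z :> nat ->
    (Sub y yB : induced center_block) != Sub z zB.
  by rewrite -val_eqE !SubK => h; apply: label_neq.
exists u, v; split.
- by apply: sub_neq; rewrite cp cr.
- apply/existsP; exists a; apply/existsP; exists b; apply/minsetP; split.
    rewrite /separates !inE !negb_or !sub_neq ?co ?cp ?cr ?ct //=.
    (* Once the hubs are removed, the labels 0 and 2 form a closed set in the center, so o does not
       reach t. *)
    apply/negP => /(@connect_in_closed _ _
      [set y : induced center_block | (c (val y) == 0 :> nat) || (c (val y) ==
          2 :> nat)]).
    rewrite !inE !SubK co ct => /(_ isT); move=> H;
        suff : (4 == 0) || (4 == 2) by []. apply: H.
    move=> y z; rewrite !inE !negb_or => cy /andP[zu zv] yz.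
    have := label_adj_val (adj_neq yz); rewrite (_ : adj (val y) (val z)) //.
    have z1 : c (val z) != 1 :> nat.
      by apply: contraNneq zu => cz; apply/eqP/val_inj; rewrite SubK;
          apply: (label_eq cp).
    have z3 : c (val z) != 3 :> nat.
      by apply: contraNneq zv => cz; apply/eqP/val_inj; rewrite SubK;
          apply: (label_eq cr).
    have := valP z; rewrite inE; move: z1 z3.
    by case/orP: cy => /eqP ->; case: (c (val z)) => [] [|[|[|[|[|?]]]]].
  move=> S /and3P[aS bS nab] Suv.
  (* Minimality: each hub is a common neighbour of o and t and so belongs to every set separating
     them. *)
  have common w : adj a w -> adj w b -> w \in S.
    move=> aw wb; apply/negPn/negP => wS; move/negP: nab; apply.
    by apply: (@connect_in_trans _ _ _ w); apply: connect_in_adj; rewrite ?inE.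
  apply/eqP; rewrite eqEsubset Suv; apply/subsetP => w; rewrite !inE => /orP[] /eqP ->.
    apply: common; [rewrite (_ : adj a u = adj o p) // | rewrite (_ : adj u b =
        adj p t) //].
      by rewrite label_adj_val ?co ?cp // label_neq // -val_eqE /= co cp.
    by rewrite label_adj_val ?ct ?cp // label_neq // -val_eqE /= ct cp.
  apply: common; [rewrite (_ : adj a v = adj o r) // | rewrite (_ : adj v b =
      adj r t) //].
    by rewrite label_adj_val ?co ?cr // label_neq // -val_eqE /= co cr.
  by rewrite label_adj_val ?ct ?cr // label_neq // -val_eqE /= ct cr.
- apply/setP => y; rewrite !inE SubK; apply/idP/eqP => [|->]; last by rewrite cp.
  case/andP=> y5 /orP[/eqP cy|/eqP cy]; last by rewrite cy in y5.
  exact: (label_eq cp).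
- apply/setP => y; rewrite !inE SubK; apply/idP/eqP => [|->]; last by rewrite cr.
  case/andP=> y5 /orP[/eqP cy|/eqP cy]; last by rewrite cy in y5.
  exact: (label_eq cr).
Qed.
End Triple.

(** * From a triple block graph to a labelling *)

Lemma mvs_common (K : sgraph) (S : {set K}) : mvs S ->
  exists a b : K, [/\ a != b, ~~ adj a b & forall w, adj a w -> adj w b -> w \in S].
Proof.
case/existsP=> a /existsP[b /minsetP[/and3P[aS bS nab] _]]; exists a, b; split.
- by apply: contraNneq nab => ->; apply: connect0.
- by apply: contra nab => ab; apply: connect_in_adj; rewrite ?inE.
- move=> w aw wb; apply: contraR nab => wS.
  by apply: (@connect_in_trans _ _ _ w); apply: connect_in_adj; rewrite ?inE.
Qed.

Definition center_labels (K : sgraph) (u v : K) (k : K -> nat) :=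
  [/\ forall x, k x < 5, injective k, k u = 1, k v = 3 &
      forall x y, x != y -> adj x y = ladj (k x) (k y)].

Lemma set2_hubs (T : finType) (x y u v : T) : x != y -> x \in [set u; v] ->
  y \in [set u; v] -> (x = u /\ y = v) \/ (x = v /\ y = u).
Proof.
move=> xy; rewrite !inE => /orP[] /eqP ex /orP[] /eqP ey; move: xy;
    rewrite ex ey ?eqxx //.
  by left.
by right.
Qed.

(** In the full house and in the diamond, any two distinct nonadjacent vertices have the vertices 0
    and 1 as common neighbours. By [mvs_common] these two are u and v in some order. *)
Lemma center_labelling (K : sgraph) (u v : K) :
  isomorphic K full_house \/ isomorphic K diamond -> mvs [set u; v] ->
  exists k, center_labels u v k.
Proof.
move=> iso /mvs_common[a [b [ab nab common]]].
case: iso => -[f [g fK gK] f_mono].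
  have f_inj := can_inj fK.
  have gadj w (i : full_house) : adj w (g i) = adj (f w) i by rewrite -f_mono gK.
  have gadj' w (i : full_house) : adj (g i) w = adj i (f w) by rewrite -f_mono gK.
  pose i0 : full_house := @Ordinal 5 0 isT; pose i1 : full_house := @Ordinal 5 1 isT.
  have fab : f a != f b by rewrite (inj_eq f_inj).
  rewrite -f_mono in nab.
  have hub (i : full_house) : val i < 2 -> g i \in [set u; v].
    move=> i2; apply: common; rewrite ?gadj ?gadj'; move: fab nab i2;
        rewrite /= /edge_adj -!val_eqE /=;
    by case: (f a) => [[|[|[|[|[|?]]]]] ?]; case: (f b) => [[|[|[|[|[|?]]]]] ?];
      case: i => [[|[|[|[|[|?]]]]] ?].
  have g01 : g i0 != g i1 by rewrite (inj_eq (can_inj gK)).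
  (* The two tables differ by the automorphism exchanging the hubs, which allows u to receive the
     label 1 and v the label 3. *)
  have tab (L : seq nat) : L \in [:: [:: 1; 3; 0; 2; 4]; [:: 3; 1; 0; 2; 4]] ->
     nth 0 L (f u) = 1 -> nth 0 L (f v) = 3 -> center_labels u v (fun x =>
         nth 0 L (f x)).
    move=> hL Lu Lv; split => //.
    - by move=> x; move: hL; rewrite !inE => /orP[] /eqP ->;
        case: (f x) => [[|[|[|[|[|?]]]]] ?].
    - move=> x y e; apply: f_inj; apply: val_inj; move: hL e; rewrite !inE.
      by case/orP => /eqP ->; case: (f x) => [[|[|[|[|[|?]]]]] ?];
          case: (f y) => [[|[|[|[|[|?]]]]] ?].
    - move=> x y; rewrite -(inj_eq f_inj) -f_mono /= /edge_adj -!val_eqE /=;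
        move: hL; rewrite !inE.
      by case/orP => /eqP ->; case: (f x) => [[|[|[|[|[|?]]]]] ?];
          case: (f y) => [[|[|[|[|[|?]]]]] ?].
  case: (set2_hubs g01 (hub i0 isT) (hub i1 isT)) => -[gu gv].
    by exists (fun x => nth 0 [:: 1; 3; 0; 2; 4] (f x)); apply: tab;
        rewrite ?inE ?eqxx // -?gu -?gv gK.
  by exists (fun x => nth 0 [:: 3; 1; 0; 2; 4] (f x)); apply: tab;
      rewrite ?inE ?eqxx ?orbT // -?gu -?gv gK.
have f_inj := can_inj fK.
have gadj w (i : diamond) : adj w (g i) = adj (f w) i by rewrite -f_mono gK.
have gadj' w (i : diamond) : adj (g i) w = adj i (f w) by rewrite -f_mono gK.
pose i0 : diamond := @Ordinal 4 0 isT; pose i1 : diamond := @Ordinal 4 1 isT.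
have fab : f a != f b by rewrite (inj_eq f_inj).
rewrite -f_mono in nab.
have hub (i : diamond) : val i < 2 -> g i \in [set u; v].
  move=> i2; apply: common; rewrite ?gadj ?gadj'; move: fab nab i2;
      rewrite /= /edge_adj -!val_eqE /=;
  by case: (f a) => [[|[|[|[|?]]]] ?]; case: (f b) => [[|[|[|[|?]]]] ?];
    case: i => [[|[|[|[|?]]]] ?].
have g01 : g i0 != g i1 by rewrite (inj_eq (can_inj gK)).
have tab (L : seq nat) : L \in [:: [:: 1; 3; 0; 4]; [:: 3; 1; 0; 4]] ->
   nth 0 L (f u) = 1 -> nth 0 L (f v) = 3 -> center_labels u v (fun x => nth 0 L (f x)).
  move=> hL Lu Lv; split => //.
  - by move=> x; move: hL; rewrite !inE => /orP[] /eqP ->;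
      case: (f x) => [[|[|[|[|?]]]] ?].
  - move=> x y e; apply: f_inj; apply: val_inj; move: hL e; rewrite !inE.
    by case/orP => /eqP ->; case: (f x) => [[|[|[|[|?]]]] ?];
        case: (f y) => [[|[|[|[|?]]]] ?].
  - move=> x y; rewrite -(inj_eq f_inj) -f_mono /= /edge_adj -!val_eqE /=;
      move: hL; rewrite !inE.
    by case/orP => /eqP ->; case: (f x) => [[|[|[|[|?]]]] ?];
        case: (f y) => [[|[|[|[|?]]]] ?].
case: (set2_hubs g01 (hub i0 isT) (hub i1 isT)) => -[gu gv].
  by exists (fun x => nth 0 [:: 1; 3; 0; 4] (f x)); apply: tab;
      rewrite ?inE ?eqxx // -?gu -?gv gK.
by exists (fun x => nth 0 [:: 3; 1; 0; 4] (f x)); apply: tab;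
    rewrite ?inE ?eqxx ?orbT // -?gu -?gv gK.
Qed.

Lemma triple_labelling (p q : nat) (H : sgraph) : triple_block_graph p q H ->
  exists2 c : H -> 'I_9, label_adjacency c &
    (forall x y, c x = c y -> x = y \/ 4 < c x) /\ (forall x, c x < 7).
Proof.
case=> _ [B [P [Q [[bl _] iso [clP _] [clQ _] [u [v [uv uvm BP BQ]]]]]]].
have [k [k5 k_inj ku kv kadj]] := center_labelling iso uvm.
have Bmax : maxset (@nonseparable H) B.
  have : B \in blocks H by rewrite bl !inE eqxx.
  by rewrite inE.
have inBP x : x \in B -> x \in P -> x = val u.
  by move=> xB xP; apply/set1P; rewrite -BP inE xB.
have inBQ x : x \in B -> x \in Q -> x = val v.
  by move=> xB xQ; apply/set1P; rewrite -BQ inE xB.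
have uP : val u \in P by have := set11 (val u); rewrite -BP inE => /andP[].
have vQ : val v \in Q by have := set11 (val v); rewrite -BQ inE => /andP[].
have uvv : val u != val v by rewrite val_eqE.
(* A vertex of both cliques outside [B] would be adjacent to u and to v, and could be added to the
   block [B]. *)
have inPQ x : x \in P -> x \in Q -> x \in B.
  move=> xP xQ; have [uB vB] := (valP u, valP v).
  have [->//|xu] := eqVneq x (val u); have [->//|xv] := eqVneq x (val v).
  have adjP : adj x (val u) by apply: (cliqueP _ clP).
  have adjQ : adj x (val v) by apply: (cliqueP _ clQ).
  have [Bn Bm] := maxsetP Bmax.
  have := Bm _ (nonseparableU1 Bn uB vB uvv adjP adjQ) (subsetUr _ _).
  by move=> <-; rewrite setU11.
(* A vertex outside both [B] and [P] lies in [Q], since the blocks cover [H]; so 6 is the label of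
   [Q] outside [B]. *)
pose n x := if insub x is Some y then k (y : induced B) else if x \in P then 5 else 6.
have nE x : [\/ exists2 y : induced B, x = val y & n x = k y,
    [/\ x \notin B, x \in P & n x = 5] | [/\ x \notin B, x \in Q & n x = 6]].
  rewrite /n; case: insubP => [y _ <-|xB]; first by apply: Or31; exists y.
  case: ifP => xP; first by apply: Or32.
  apply: Or33; split=> //; have [C] := block_cover x.
  by rewrite bl !inE => /orP[/orP[]|] /eqP ->; rewrite ?(negbTE xB) ?xP.
have n7 x : n x < 7.
  by case: (nE x) => [[y _ ->]|[_ _ ->]|[_ _ ->]] //; apply: leq_trans (k5 y) _.
have n9 x : n x < 9 by apply: leq_trans (n7 x) _.
exists (fun x => Ordinal (n9 x)); last first.
  split=> // x y /(congr1 val) /= e;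
      case: (nE x) e => [[x' -> ->]|[_ _ ->]|[_ _ ->]]; try by right.
  case: (nE y) => [[y' -> ->]|[_ _ ->]|[_ _ ->]] e; first by left;
      rewrite (k_inj _ _ e).
    by have := k5 x'; rewrite e.
  by have := k5 x'; rewrite e.
have cross x y : adj x y -> [\/ (x \in B) && (y \in B), (x \in P) && (y \in P) |
    (x \in Q) && (y \in Q)].
  move=> /edge_in_block[C]; rewrite bl !inE => /orP[/orP[]|] /eqP ->.
  - exact: Or31.
  - exact: Or32.
  - exact: Or33.
have sideP x y : x \notin B -> x \in P -> adj x y = (x != y) && (y \in P).
  move=> xB xP; apply/idP/andP => [xy|[xy yP]]; last exact: (cliqueP _ clP).
  split; first exact: (@adj_neq H).
  case: (cross x y xy) => /andP[]; rewrite ?(negbTE xB) // => xQ _.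
  by rewrite inPQ in xB.
have sideQ x y : x \notin B -> x \in Q -> adj x y = (x != y) && (y \in Q).
  move=> xB xQ; apply/idP/andP => [xy|[xy yQ]]; last exact: (cliqueP _ clQ).
  split; first exact: (@adj_neq H).
  case: (cross x y xy) => /andP[]; rewrite ?(negbTE xB) // => xP _.
  by rewrite inPQ in xB.
have BinP (y : induced B) : (val y \in P) = (k y == 1).
  rewrite -ku (inj_eq k_inj); apply/idP/eqP => [yP|-> //].
  by apply/val_inj/inBP => //; apply: valP.
have BinQ (y : induced B) : (val y \in Q) = (k y == 3).
  rewrite -kv (inj_eq k_inj); apply/idP/eqP => [yQ|-> //].
  by apply/val_inj/inBQ => //; apply: valP.
move=> x y xy; rewrite -val_eqE /=.
case: (nE x) => [[x' ex nx]|[xB xP nx]|[xB xQ nx]];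
  case: (nE y) => [[y' ey ny]|[yB yP ny]|[yB yQ ny]]; rewrite nx ny.
- have xy' : x' != y' by rewrite -val_eqE -ex -ey.
  by rewrite (inj_eq k_inj) (negbTE xy') -kadj // ex ey.
- rewrite adj_sym sideP // eq_sym xy ex BinP.
  by move: (k5 x'); case: (k x') => [|[|[|[|[|?]]]]].
- rewrite adj_sym sideQ // eq_sym xy ex BinQ.
  by move: (k5 x'); case: (k x') => [|[|[|[|[|?]]]]].
- rewrite sideP // xy ey BinP.
  by move: (k5 y'); case: (k y') => [|[|[|[|[|?]]]]].
- by rewrite sideP // xy yP.
- rewrite sideP // xy /=; apply/negbTE; apply: contra yB => yP; exact: inPQ.
- rewrite sideQ // xy ey BinQ.
  by move: (k5 y'); case: (k y') => [|[|[|[|[|?]]]]].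
- rewrite sideQ // xy /=; apply/negbTE; apply: contra yB => yQ; exact: inPQ.
- by rewrite sideQ // xy yQ.
Qed.

Lemma labelling_induced (G H : sgraph) (c : H -> 'I_9) :
  connected_induced_subgraph_of G H -> labelling c ->
  exists c' : G -> 'I_9, labelling c'.
Proof.
case=> A [_ [f f_bij f_mono]] [cadj cH]; have f_inj := bij_inj f_bij.
have vf_inj x y : val (f x) = val (f y) -> x = y by move=> /val_inj/f_inj.
exists (fun x => c (val (f x))); split=> [x y xy|].
  rewrite -f_mono -cadj //; last by apply: contraNneq xy => /vf_inj ->.
case: cH => [[same lt7]|inj]; last by right; apply: inj_comp inj _.
left; split=> [x y /same[/vf_inj|]|x]; [by left | by right | exact: lt7].
Qed.

Lemma Pt1_labelling : @labelling Pt1 id.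
Proof.
split; last by right.
by move=> x y xy; rewrite (negbTE xy) /= /edge_adj xy.
Qed.

Lemma injective_label_Pt1 (G : sgraph) (c : G -> 'I_9) :
  connected G -> label_adjacency c -> injective c ->
  connected_induced_subgraph_of G Pt1.
Proof.
move=> G_conn c_adj c_inj; pose A : {set Pt1} := c @: setT.
have cA x : c x \in A by apply: imset_f.
have iso : isomorphic G (induced A).
  exists (fun x => Sub (c x) (cA x)).
    apply: inj_surj_bij => [x y /(congr1 val)|y]; first by rewrite /= => /c_inj.
    by have /imsetP[x _ yx] := valP y; exists x; apply: val_inj; rewrite /= yx.
  move=> x y; have [<-|xy] := eqVneq x y; first by rewrite !adj_irr.
  by rewrite c_adj // /= /edge_adj (inj_eq c_inj) (negbTE xy).
by exists A; split=> //; apply: isomorphic_connected iso G_conn.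
Qed.

Local Open Scope ring_scope.

Theorem corollary2 (R : rcfType) (G : sgraph)
    (G_connected : connected G)
    (G_diameter : diameter G = 3%N)
    (G_not_block : ~~ block_graph G) :
  lambda R G 2 < - (1 / 2) <->
  connected_induced_subgraph_of G Pt1 \/
  (exists (p q : nat) (H : sgraph),
     [/\ (2 <= p)%N, (2 <= q)%N, triple_block_graph p q H
       & connected_induced_subgraph_of G H]).
Proof.
split=> [lam|].
  have [c c_adj [[same lt7 hit]|c_inj]] :=
    necessary_labelling G_connected lam G_diameter G_not_block; last first.
    by left; apply: injective_label_Pt1 c_inj.
  (* Here [G] is itself a triple block graph and is taken as the induced subgraph on all its
     vertices. *)
  right; have [o co] := hit 0%N isT; have [p cp] := hit 1%N isT.
  have [r cr] := hit 3%N isT; have [t ct] := hit 4%N isT.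
  have [s cs] := hit 5%N isT; have [x cx] := hit 6%N isT.
  have [tri [P2 Q2]] := labelling_triple G_connected c_adj same lt7 cp cr co ct cs cx.
  exists #|left_block c|, #|right_block c|, G; split=> //.
  have iso := isomorphic_induced_setT G.
  by exists [set: G]; split=> //; apply: isomorphic_connected iso G_connected.
case=> [sub|[p [q [H [_ _ /triple_labelling[c c_adj c_pt2] sub]]]]].
  have [c c_lab] := labelling_induced sub Pt1_labelling.
  exact: labelling_lambda2 c_lab.
have c_lab : labelling c by split=> //; left.
have [c' c_lab'] := labelling_induced sub c_lab.
exact: labelling_lambda2 c_lab'.
Qed.
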